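(* Let $k_1>0$, $k_2>0$ and let $u_0\in H^s(\mathbb{S})$, $s>5/2$, $u_0\neq0$, with $\int_{\mathbb{S}}u_0\,dx=0$. Then the corresponding maximal strong solution $u(t,x)$ of the Cauchy problem $$m_t+k_1\big((2\mu(u)u-u_x^2)m\big)_x+k_2(2mu_x+um_x)=0,\qquad m=\mu(u)-u_{xx},\qquad u(0,x)=u_0(x),$$ with $u$ $1$-periodic in $x$, blows up in finite time $T^*<\infty$.
   Context: $\mathbb{S}=\mathbb{R}/\mathbb{Z}$; $\mu(u)=\int_{\mathbb{S}}u(t,x)\,dx$. Strong solution: $u\in C([0,T);H^s)\cap C^1([0,T);H^{s-1})$ satisfying the equation. Blowing up in finite time means that the maximal existence time of the strong solution is finite. *)

(* Defs.v *)
From Stdlib Require Export Reals ZArith.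
From Coquelicot Require Export Coquelicot.
Open Scope R_scope.

(** Functions on the circle R/Z are 1-periodic functions [R -> R]. *)

Definition periodic1 (f : R -> R) : Prop := forall x, f (x + 1) = f x.

Definition mean (f : R -> R) : R := RInt f 0 1.

(** [fourier f n] is the integral over [0,1] of [f x * exp (- 2 i PI n x)]. *)
Definition fourier (f : R -> R) (n : Z) : C :=
  (RInt (fun x => f x * cos (2 * PI * IZR n * x)) 0 1,
   - RInt (fun x => f x * sin (2 * PI * IZR n * x)) 0 1).

Definition Hs_weighted (s : R) (f : R -> R) (n : Z) : R :=
  Rpower (1 + IZR n ^ 2) s * Cmod (fourier f n) ^ 2.

(** The frequencies in Z are enumerated as the pairs [n], [-(n+1)], n in nat;
    all terms are nonnegative, so the order of summation is irrelevant. *)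
Definition Hs_terms (s : R) (f : R -> R) (n : nat) : R :=
  Hs_weighted s f (Z.of_nat n) + Hs_weighted s f (- Z.of_nat (S n)).

(** The Sobolev space H^s(R/Z), for s > 1/2 only: its elements are then
    identified with their continuous representatives. *)
Definition Hs (s : R) (f : R -> R) : Prop :=
  periodic1 f /\ (forall x, continuous f x) /\ ex_series (Hs_terms s f).

Definition Hs_norm (s : R) (f : R -> R) : R := sqrt (Series (Hs_terms s f)).

Definition time_interval (T : Rbar) (t : R) : Prop := 0 <= t /\ Rbar_lt t T.

(** C([0,T); H^s). *)
Definition C0_Hs (s : R) (T : Rbar) (u : R -> R -> R) : Prop :=
  forall t, time_interval T t ->
    Hs s (u t) /\
    filterlim (fun t' => Hs_norm s (fun x => u t' x - u t x))
      (within (time_interval T) (locally t)) (locally 0).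

(** C^1([0,T); H^s): the difference quotients converge in H^s, one-sidedly at
    t = 0, to a curve in C([0,T); H^s). *)
Definition C1_Hs (s : R) (T : Rbar) (u : R -> R -> R) : Prop :=
  C0_Hs s T u /\
  exists ut : R -> R -> R, C0_Hs s T ut /\
    forall t, time_interval T t ->
      filterlim
        (fun t' => Hs_norm s (fun x => (u t' x - u t x) / (t' - t) - ut t x))
        (within (time_interval T) (locally' t)) (locally 0).

(** For u(t) in H^s with s > 5/2, hence of class C^2 in x, the momentum m(t) is
    a continuous function, whereas m_t and m_x lie in H^(s-3), which for
    s <= 7/2 contains distributions that are not functions.  The equation is therefore
    an equality of distributions on the circle. *)

Definition momentum (f : R -> R) (x : R) : R := mean f - Derive_n f 2 x.

Definition test_function (phi : R -> R) : Prop :=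
  periodic1 phi /\ forall n x, ex_derive_n phi n x.

Definition pairing (f phi : R -> R) : R := RInt (fun x => f x * phi x) 0 1.

(** The distributional derivative of a continuous function; it has order at
    most one, so that it may be paired with any C^1 function. *)
Definition pairing_dx (f phi : R -> R) : R := - pairing f (Derive phi).

(** <((2 mu(f) f - f_x^2) m)_x, phi>. *)
Definition cubic_part (f phi : R -> R) : R :=
  pairing_dx
    (fun x => (2 * mean f * f x - Derive f x ^ 2) * momentum f x) phi.

(** <2 m f_x + f m_x, phi>, where <f m_x, phi> = <m_x, f phi>. *)
Definition quadratic_part (f phi : R -> R) : R :=
  pairing (fun x => 2 * momentum f x * Derive f x) phi
  + pairing_dx (momentum f) (fun x => f x * phi x).

(** Here [dm] is <m_t, phi>: m_t is the derivative in time of the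
    distribution-valued curve m. *)
Definition satisfies_equation (k1 k2 : R) (T : Rbar) (u : R -> R -> R) : Prop :=
  forall t, 0 < t -> Rbar_lt t T ->
  forall phi, test_function phi ->
  exists dm : R,
    is_derive (fun tau => pairing (momentum (u tau)) phi) t dm /\
    dm + k1 * cubic_part (u t) phi + k2 * quadratic_part (u t) phi = 0.

Definition strong_solution (k1 k2 s : R) (u0 : R -> R) (T : Rbar)
    (u : R -> R -> R) : Prop :=
  Rbar_lt 0 T /\
  C0_Hs s T u /\
  C1_Hs (s - 1) T u /\
  satisfies_equation k1 k2 T u /\
  (forall x, u 0 x = u0 x).

(** [T] is the maximal existence time of [u]: no strong solution on a longer
    interval extends [u].  The values of [u] outside [0,T) are irrelevant. *)
Definition maximal_strong_solution (k1 k2 s : R) (u0 : R -> R) (T : Rbar)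
    (u : R -> R -> R) : Prop :=
  strong_solution k1 k2 s u0 T u /\
  forall (T' : Rbar) (v : R -> R -> R),
    strong_solution k1 k2 s u0 T' v ->
    (forall t x, time_interval T t -> v t x = u t x) ->
    Rbar_le T' T.

(* Main.v *)
(** The mean of [u] is conserved, hence zero.  With [v = u_x] and [H = mean (v^2)], integrating the
    equation once in space gives
      v_t = k1 v^2 v_x - k2 (u v_x + v^2 / 2) - (k2 / 2) H.
    Multiplying by [v] shows that [H] is conserved, and multiplying by [3 v^2] that
    [F = mean (v^3)] satisfies
      F' = - (3 k2 / 2) H^2 - (k2 / 2) mean (v^4) <= - (3 k2 / 2) H^2 - k2 / (2 H) F^2
    by Cauchy-Schwarz.  This Riccati inequality has no solution on the whole half-line.  The integrated equation is obtained from the weak one by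
    testing against trigonometric functions only, a continuous function being determined by
    its Fourier coefficients. *)

Require Import Defs.
From Stdlib Require Import Lra Lia Psatz FunctionalExtensionality.

(** * Means of continuous functions, trigonometric functions *)

(** The moments are taken of [v = u_x] rather than of [m] because of regularity in time: [m_t] may
    be a mere distribution, whereas [u_t] lies in [H^(s-1)] with [s - 1 > 3/2], which embeds into
    [C^1]. Hence [v_t = (u_t)_x] is continuous and the difference quotients of [v] converge
    uniformly in [x], which is what differentiating [H] and [F] under the integral requires. As
    [H^s] is given by Fourier coefficients alone, the embedding comes from differentiating an
    absolutely convergent series term by term and recognising its primitive by uniqueness of
    coefficients. In the moments the cubic term integrates away, [v^(j+2) v_x] being an exact
    derivative; the constant [- (k2 / 2) H] is the one that makes the mean of [v_t] vanish, as it
    must for an [x]-derivative. The equation is available for [t > 0] only. The initial datum enters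
    through continuity at [t = 0]: it fixes the mean of [u], and it gives [H > 0], since a constant
    function of mean zero is zero. *)

Definition cont (f : R -> R) : Prop := forall x, continuous f x.

Lemma cont_const (c : R) : cont (fun _ => c).
Proof. intros x; apply continuous_const. Qed.

Lemma cont_id : cont (fun x => x).
Proof. intros x; apply continuous_id. Qed.

Lemma cont_plus (f g : R -> R) : cont f -> cont g -> cont (fun x => f x + g x).
Proof. intros hf hg x; exact (continuous_plus f g x (hf x) (hg x)). Qed.

Lemma cont_minus (f g : R -> R) : cont f -> cont g -> cont (fun x => f x - g x).
Proof. intros hf hg x; exact (continuous_minus f g x (hf x) (hg x)). Qed.

Lemma cont_opp (f : R -> R) : cont f -> cont (fun x => - f x).
Proof. intros hf x; exact (continuous_opp f x (hf x)). Qed.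

Lemma cont_mult (f g : R -> R) : cont f -> cont g -> cont (fun x => f x * g x).
Proof. intros hf hg x; exact (continuous_mult f g x (hf x) (hg x)). Qed.

Lemma cont_pow (f : R -> R) (n : nat) : cont f -> cont (fun x => f x ^ n).
Proof.
  intros hf; induction n as [|n IH]; simpl.
  - apply cont_const.
  - now apply cont_mult.
Qed.

Lemma cont_cos (f : R -> R) : cont f -> cont (fun x => cos (f x)).
Proof. intros hf x; exact (continuous_comp f cos x (hf x) (continuous_cos _)). Qed.

Lemma cont_sin (f : R -> R) : cont f -> cont (fun x => sin (f x)).
Proof. intros hf x; exact (continuous_comp f sin x (hf x) (continuous_sin _)). Qed.

Lemma cont_derivative (f g : R -> R) : (forall x, is_derive f x (g x)) -> cont f.
Proof. intros h x; apply (ex_derive_continuous (V := R_NormedModule)); now exists (g x). Qed.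

(** The free phase treats sines and cosines as one family: differentiation shifts the phase by
    [PI / 2], and products split into two members of the family. *)
Definition osc (n : Z) (a x : R) : R := cos (2 * PI * IZR n * x + a).

Lemma cont_osc (n : Z) (a : R) : cont (osc n a).
Proof.
  apply cont_cos, cont_plus, cont_const. apply cont_mult; [apply cont_const|apply cont_id].
Qed.

Ltac prove_cont :=
  repeat match goal with
  | H : cont ?f |- cont ?f => exact H
  | H : cont ?f |- cont (fun x => ?f x) => exact H
  | H : forall n, cont (?f n) |- cont (?f ?m) => exact (H m)
  | H : forall n, cont (?f n) |- cont (fun x => ?f ?m x) => exact (H m)
  | |- cont (osc ?n ?a) => exact (cont_osc n a)
  | |- cont (fun x => osc ?n ?a x) => exact (cont_osc n a)
  | |- cont (fun _ => ?c) => apply cont_const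
  | |- cont (fun x => x) => apply cont_id
  | |- cont (fun x => @?f x + @?g x) => apply (cont_plus f g)
  | |- cont (fun x => @?f x - @?g x) => apply (cont_minus f g)
  | |- cont (fun x => - @?f x) => apply (cont_opp f)
  | |- cont (fun x => @?f x * @?g x) => apply (cont_mult f g)
  | |- cont (fun x => @?f x ^ ?n) => apply (cont_pow f n)
  | |- cont (fun x => cos (@?f x)) => apply (cont_cos f)
  | |- cont (fun x => sin (@?f x)) => apply (cont_sin f)
  end.

Lemma cont_ex_RInt (f : R -> R) (a b : R) : cont f -> ex_RInt f a b.
Proof. intros h; apply (ex_RInt_continuous (V := R_CompleteNormedModule)); auto. Qed.

Lemma mean_ext (f g : R -> R) : (forall x, 0 <= x <= 1 -> f x = g x) -> mean f = mean g.
Proof.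
  intros h; apply RInt_ext; intros x hx.
  rewrite Rmin_left, Rmax_right in hx by lra. apply h; lra.
Qed.

Lemma mean_const (c : R) : mean (fun _ => c) = c.
Proof. unfold mean; rewrite RInt_const; unfold scal; simpl; unfold mult; simpl; ring. Qed.

Lemma mean_plus (f g : R -> R) :
  cont f -> cont g -> mean (fun x => f x + g x) = mean f + mean g.
Proof. intros hf hg; apply (RInt_plus f g 0 1); now apply cont_ex_RInt. Qed.

Lemma mean_scal (c : R) (f : R -> R) : cont f -> mean (fun x => c * f x) = c * mean f.
Proof. intros hf; apply (RInt_scal f 0 1 c); now apply cont_ex_RInt. Qed.

Lemma mean_opp (f : R -> R) : cont f -> mean (fun x => - f x) = - mean f.
Proof. intros hf; apply (RInt_opp f 0 1); now apply cont_ex_RInt. Qed.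

Lemma mean_minus (f g : R -> R) :
  cont f -> cont g -> mean (fun x => f x - g x) = mean f - mean g.
Proof. intros hf hg; apply (RInt_minus f g 0 1); now apply cont_ex_RInt. Qed.

Lemma mean_le (f g : R -> R) :
  cont f -> cont g -> (forall x, 0 <= x <= 1 -> f x <= g x) -> mean f <= mean g.
Proof.
  intros hf hg h; apply RInt_le; try (now apply cont_ex_RInt); try lra.
  intros x hx; apply h; lra.
Qed.

Lemma mean_abs_le (f : R -> R) (M : R) :
  cont f -> (forall x, 0 <= x <= 1 -> Rabs (f x) <= M) -> Rabs (mean f) <= M.
Proof.
  intros hf h. replace M with ((1 - 0) * M) by ring.
  apply abs_RInt_le_const; auto; try lra. now apply cont_ex_RInt.
Qed.

Lemma mean_derivative (F f : R -> R) :
  (forall x, is_derive F x (f x)) -> cont f -> mean f = F 1 - F 0.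
Proof.
  intros hd hc; unfold mean; apply is_RInt_unique.
  apply (is_RInt_derive F f 0 1); intros x _; auto.
Qed.

Lemma mean_periodic_derivative (F f : R -> R) :
  (forall x, is_derive F x (f x)) -> cont f -> F 1 = F 0 -> mean f = 0.
Proof. intros hd hc hp; rewrite (mean_derivative F f hd hc), hp; ring. Qed.

Lemma cont_bounded (f : R -> R) :
  cont f -> exists M, 0 <= M /\ forall x, 0 <= x <= 1 -> Rabs (f x) <= M.
Proof.
  intros hf.
  destruct (continuity_ab_maj (fun x => Rabs (f x)) 0 1) as [m [hm _]]; [lra| |].
  - intros c _. apply continuity_pt_filterlim.
    apply (continuous_comp f Rabs); [apply hf | apply continuous_Rabs].
  - exists (Rabs (f m)); split; [apply Rabs_pos | exact hm].
Qed.

Lemma cont_near (f : R -> R) (x e : R) :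
  cont f -> 0 < e -> exists d, 0 < d /\ forall y, Rabs (y - x) < d -> Rabs (f y - f x) < e.
Proof.
  intros hf he.
  destruct (proj1 (filterlim_locally f (f x)) (hf x) (mkposreal e he)) as [d hd].
  exists d; split; [apply cond_pos | exact hd].
Qed.

Lemma derivative_periodic (f g : R -> R) :
  periodic1 f -> (forall x, is_derive f x (g x)) -> periodic1 g.
Proof.
  intros hp hd x.
  rewrite <- (is_derive_unique f x (g x) (hd x)).
  symmetry; apply is_derive_unique.
  apply (is_derive_ext (fun y => f (y + 1))); [exact hp|].
  replace (g (x + 1)) with (scal 1 (g (x + 1))) by (unfold scal; simpl; unfold mult; simpl; ring).
  apply (is_derive_comp f (fun y => y + 1)); [apply hd | auto_derive; [easy|ring]].
Qed.

Lemma periodic1_unit_interval (f : R -> R) (x : R) :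
  periodic1 f -> exists y, 0 <= y < 1 /\ f y = f x.
Proof.
  intros hp.
  assert (hN : forall (n : nat) y, f (y + INR n) = f y).
  { induction n as [|n IH]; intros y; [f_equal; simpl; ring|].
    rewrite S_INR; replace (y + (INR n + 1)) with ((y + INR n) + 1) by ring.
    now rewrite hp. }
  assert (hZ : forall (k : Z) y, f (y + IZR k) = f y).
  { intros k y. destruct (Z_le_gt_dec 0 k) as [h|h].
    - rewrite <- (Z2Nat.id k h), <- INR_IZR_INZ; apply hN.
    - rewrite <- (hN (Z.to_nat (- k)) (y + IZR k)). f_equal.
      rewrite INR_IZR_INZ, Z2Nat.id, opp_IZR by lia; ring. }
  exists (x + IZR (- Int_part x)); split; [|apply hZ].
  rewrite opp_IZR. destruct (base_Int_part x); lra.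
Qed.

Lemma cos_add_2PI_IZR (n : Z) (a : R) : cos (a + 2 * PI * IZR n) = cos a.
Proof.
  assert (hN : forall m b, cos (b + 2 * PI * INR m) = cos b).
  { intros m b. replace (b + 2 * PI * INR m) with (b + 2 * INR m * PI) by ring.
    apply cos_period. }
  destruct (Z_le_gt_dec 0 n) as [h|h].
  - rewrite <- (Z2Nat.id n h), <- INR_IZR_INZ; apply hN.
  - rewrite <- (hN (Z.to_nat (- n)) (a + 2 * PI * IZR n)). f_equal.
    rewrite INR_IZR_INZ, Z2Nat.id, opp_IZR by lia; ring.
Qed.

Lemma osc_periodic (n : Z) (a : R) : periodic1 (osc n a).
Proof.
  intros x; unfold osc.
  replace (2 * PI * IZR n * (x + 1) + a) with ((2 * PI * IZR n * x + a) + 2 * PI * IZR n) by ring.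
  apply cos_add_2PI_IZR.
Qed.

Lemma is_derive_osc (n : Z) (a x : R) :
  is_derive (osc n a) x (2 * PI * IZR n * osc n (a + PI / 2) x).
Proof.
  unfold osc. auto_derive; [easy|].
  replace (2 * PI * IZR n * x + (a + PI / 2)) with (PI / 2 + (2 * PI * IZR n * x + a)) by ring.
  rewrite <- (Ropp_involutive (cos (PI / 2 + _))), <- sin_cos. ring.
Qed.

Lemma osc_mult (m n : Z) (a b x : R) :
  osc m a x * osc n b x = / 2 * osc (m + n) (a + b) x + / 2 * osc (m - n) (a - b) x.
Proof.
  unfold osc. rewrite plus_IZR, minus_IZR.
  set (p := 2 * PI * IZR m * x + a). set (q := 2 * PI * IZR n * x + b).
  replace (2 * PI * (IZR m + IZR n) * x + (a + b)) with (p + q) by (unfold p, q; ring).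
  replace (2 * PI * (IZR m - IZR n) * x + (a - b)) with (p - q) by (unfold p, q; ring).
  rewrite cos_plus, cos_minus; field.
Qed.

Lemma mean_osc (n : Z) (a : R) : n <> 0%Z -> mean (osc n a) = 0.
Proof.
  intros hn.
  assert (hn' : 2 * PI * IZR n <> 0).
  { apply Rmult_integral_contrapositive_currified; [|now apply eq_IZR_contrapositive].
    generalize PI_RGT_0; lra. }
  apply mean_periodic_derivative with (F := fun x => / (2 * PI * IZR n) * osc n (a - PI / 2) x).
  - intros x. replace (osc n a x) with
      (/ (2 * PI * IZR n) * (2 * PI * IZR n * osc n (a - PI / 2 + PI / 2) x)).
    + apply is_derive_scal, is_derive_osc.
    + replace (a - PI / 2 + PI / 2) with a by ring. now rewrite <- Rmult_assoc, Rinv_l, Rmult_1_l.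
  - apply cont_osc.
  - f_equal. replace 1 with (0 + 1) by ring. apply osc_periodic.
Qed.

Lemma mean_osc_0 (a : R) : mean (osc 0 a) = cos a.
Proof.
  rewrite <- (mean_const (cos a)); apply mean_ext; intros x _; unfold osc; f_equal; ring.
Qed.

(** * Uniqueness of Fourier coefficients *)

Definition no_fourier (f : R -> R) : Prop := forall n a, mean (fun x => f x * osc n a x) = 0.

(** Multiplying by [osc 1 b] only moves the frequency [n] to [n + 1] and [n - 1], where the
    coefficients vanish as well. Iterated, this makes [f] orthogonal to all powers of a peaked
    kernel. *)
Lemma no_fourier_mult_kernel (f : R -> R) (c b : R) :
  cont f -> no_fourier f -> no_fourier (fun x => f x * (c + osc 1 b x)).
Proof.
  intros hf h n a. pose proof cont_osc as ho.
  rewrite (mean_ext _ (fun x => c * (f x * osc n a x)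
     + (/ 2 * (f x * osc (1 + n) (b + a) x) + / 2 * (f x * osc (1 - n) (b - a) x)))).
  - rewrite !mean_plus, !mean_scal, !h; [ring| | | | | | |]; prove_cont; apply ho.
  - intros x _. pose proof (osc_mult 1 n b a x) as e.
    rewrite <- Rmult_plus_distr_l in e.
    transitivity (c * (f x * osc n a x) + f x * (osc 1 b x * osc n a x)); [ring|].
    rewrite e; ring.
Qed.

Lemma no_fourier_mult_kernel_pow (f : R -> R) (c b : R) (k : nat) :
  cont f -> no_fourier f -> no_fourier (fun x => f x * (c + osc 1 b x) ^ k).
Proof.
  intros hf h; induction k as [|k IH]; intros n a.
  - rewrite <- (h n a). apply mean_ext; intros x _; simpl; ring.
  - rewrite <- (no_fourier_mult_kernel _ c b) with (n := n) (a := a) (2 := IH).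
    + apply mean_ext; intros x _; simpl; ring.
    + pose proof cont_osc; prove_cont; apply cont_osc.
Qed.

(* The powers of [1 + cos (2 PI (x - x0)) - cos (2 PI d)] are bounded by 1 off the
   d-neighbourhood of [x0] and grow geometrically on the neighbourhood of half the size. *)
Lemma no_fourier_not_pos (f : R -> R) (x0 : R) :
  cont f -> no_fourier f -> 0 < x0 < 1 -> f x0 <= 0.
Proof.
  intros hf h hx0. destruct (Rle_or_lt (f x0) 0) as [|hpos]; [assumption|exfalso].
  set (c := f x0 / 2).
  destruct (cont_near f x0 c hf ltac:(unfold c; lra)) as [d0 [hd0 hnear]].
  (* Below [d0], so that [f > c] on the [d]-neighbourhood of [x0]; below [x0] and [1 - x0], so that
     this neighbourhood stays inside one period. *)
  set (d := Rmin (d0 / 2) (Rmin (/ 4) (Rmin (x0 / 2) ((1 - x0) / 2)))).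
  assert (hd : 0 < d /\ d < d0 /\ d <= / 4 /\ d < x0 /\ d < 1 - x0).
  { unfold d. repeat split.
    - repeat apply Rmin_glb_lt; lra.
    - eapply Rle_lt_trans; [apply Rmin_l|lra].
    - eapply Rle_trans; [apply Rmin_r|apply Rmin_l].
    - eapply Rle_lt_trans; [apply Rmin_r|]. eapply Rle_lt_trans; [apply Rmin_r|].
      eapply Rle_lt_trans; [apply Rmin_l|lra].
    - eapply Rle_lt_trans; [apply Rmin_r|]. eapply Rle_lt_trans; [apply Rmin_r|].
      eapply Rle_lt_trans; [apply Rmin_r|lra]. }
  clearbody d. destruct hd as [hd [hdd0 [hd4 [hdx hdx']]]].
  pose proof PI_RGT_0 as hpi.
  set (Q := fun x => (1 - cos (2 * PI * d)) + osc 1 (- (2 * PI * x0)) x).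
  assert (hosc : forall x, osc 1 (- (2 * PI * x0)) x = cos (2 * PI * Rabs (x - x0))).
  { intros x. unfold osc. destruct (Rle_or_lt 0 (x - x0)).
    - rewrite Rabs_pos_eq by assumption. f_equal; ring.
    - rewrite Rabs_left, <- cos_neg by assumption. f_equal; ring. }
  assert (hQc : cont Q) by (unfold Q; prove_cont; apply cont_osc).
  assert (hmon : forall r s, 0 <= r <= s -> s <= / 2 -> cos (2 * PI * s) <= cos (2 * PI * r)).
  { intros r s hr hs. apply cos_decr_1; nra. }
  (* The value of [Q] at distance [d / 2] from [x0], its minimum on the half-size neighbourhood. *)
  set (q := 1 - cos (2 * PI * d) + cos (PI * d)).
  assert (hq : 1 < q).
  { unfold q. assert (cos (2 * PI * d) < cos (PI * d)); [|lra].
    apply cos_decreasing_1; nra. }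
  assert (hQin : forall x, Rabs (x - x0) <= d / 2 -> q <= Q x).
  { intros x hx. unfold Q, q. rewrite hosc.
    replace (PI * d) with (2 * PI * (d / 2)) by field.
    pose proof (Rabs_pos (x - x0)).
    pose proof (hmon (Rabs (x - x0)) (d / 2) ltac:(lra) ltac:(lra)). lra. }
  assert (hQnear : forall x, Rabs (x - x0) <= d -> 0 <= Q x).
  { intros x hx. unfold Q. rewrite hosc. pose proof (Rabs_pos (x - x0)).
    pose proof (hmon (Rabs (x - x0)) d ltac:(lra) ltac:(lra)). lra. }
  assert (hQout : forall x, 0 <= x <= 1 -> d < Rabs (x - x0) -> Rabs (Q x) <= 1).
  { intros x hx hxd. unfold Q. rewrite hosc. apply Rabs_le.
    pose proof (COS_bound (2 * PI * Rabs (x - x0))). pose proof (COS_bound (2 * PI * d)).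
    assert (0 <= cos (2 * PI * d)) by (apply cos_ge_0; nra).
    assert (cos (2 * PI * Rabs (x - x0)) <= cos (2 * PI * d)); [|lra].
    destruct (Rle_or_lt (Rabs (x - x0)) (/ 2)) as [h2|h2].
    - apply hmon; lra.
    (* Beyond half a period the nearest translate of [x0] is at distance [1 - Rabs (x - x0)], still
       at least [d]. *)
    - replace (cos (2 * PI * Rabs (x - x0))) with (cos (2 * PI * (1 - Rabs (x - x0)))).
      + assert (Rabs (x - x0) <= 1 - d) by (apply Rabs_le; lra).
        apply hmon; lra.
      + rewrite <- cos_neg, <- (cos_add_2PI_IZR 1). f_equal; ring. }
  destruct (cont_bounded f hf) as [M [hM hMf]].
  assert (hlow : forall k x, 0 <= x <= 1 -> - M <= f x * Q x ^ k).
  { intros k x hx. destruct (Rle_or_lt (Rabs (x - x0)) d) as [hxd|hxd].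
    - assert (0 <= f x).
      { assert (Rabs (f x - f x0) < c) by (apply hnear; lra).
        unfold c in *. apply Rabs_def2 in H. lra. }
      pose proof (pow_le (Q x) k (hQnear x hxd)). nra.
    - assert (Rabs (f x * Q x ^ k) <= M).
      { rewrite Rabs_mult. rewrite <- (Rmult_1_r M).
        apply Rmult_le_compat; try apply Rabs_pos; [now apply hMf|].
        rewrite <- RPow_abs. rewrite <- (pow1 k).
        apply pow_incr; split; [apply Rabs_pos | now apply hQout]. }
      pose proof (Rle_abs (- (f x * Q x ^ k))). rewrite Rabs_Ropp in H0. lra. }
  set (a := x0 - d / 2). set (b := x0 + d / 2).
  (* The mean of [f * Q ^ k] is zero, its part on [[a, b]] is at least [c * d * q ^ k], and the rest
     is at least [- M] times a length below 1. Letting [k] grow contradicts [q > 1]. *)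
  assert (hk : forall k, c * d * q ^ k <= 2 * M).
  { intros k.
    set (g := fun x => f x * Q x ^ k).
    assert (hg : cont g) by (unfold g; prove_cont).
    assert (hz : mean g = 0).
    { pose proof (no_fourier_mult_kernel_pow f (1 - cos (2 * PI * d)) (- (2 * PI * x0)) k hf h 0%Z 0) as e.
      rewrite <- e. apply mean_ext; intros x _. unfold osc at 2. rewrite Rmult_0_r, Rmult_0_l.
      rewrite Rplus_0_r, cos_0, Rmult_1_r. reflexivity. }
    assert (hchunk : forall l r m, l <= r -> (forall x, l < x < r -> m <= g x) ->
               (r - l) * m <= RInt g l r).
    { intros l r m hlr hm.
      replace ((r - l) * m) with (RInt (fun _ => m) l r) by (rewrite RInt_const; reflexivity).
      apply RInt_le; auto; apply cont_ex_RInt; [apply cont_const|assumption]. }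
    assert (e1 : RInt g 0 a + RInt g a 1 = mean g)
      by (apply (RInt_Chasles g 0 a 1); now apply cont_ex_RInt).
    assert (e2 : RInt g a b + RInt g b 1 = RInt g a 1)
      by (apply (RInt_Chasles g a b 1); now apply cont_ex_RInt).
    pose proof (hchunk 0 a (- M) ltac:(unfold a; lra)) as i1.
    pose proof (hchunk b 1 (- M) ltac:(unfold b; lra)) as i3.
    pose proof (hchunk a b (c * q ^ k) ltac:(unfold a, b; lra)) as i2.
    assert (j1 : (a - 0) * - M <= RInt g 0 a)
      by (apply i1; intros x hx; apply hlow; unfold a in hx; lra).
    assert (j3 : (1 - b) * - M <= RInt g b 1)
      by (apply i3; intros x hx; apply hlow; unfold b in hx; lra).
    assert (j2 : (b - a) * (c * q ^ k) <= RInt g a b).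
    { apply i2; intros x hx. unfold a, b in hx.
      assert (hxd : Rabs (x - x0) <= d / 2) by (apply Rabs_le; lra).
      assert (Rabs (f x - f x0) < c) by (apply hnear; lra).
      apply Rabs_def2 in H. unfold g. apply Rmult_le_compat.
      - unfold c; lra.
      - apply pow_le; lra.
      - unfold c in *; lra.
      - apply pow_incr; split; [lra | now apply hQin]. }
    unfold a, b in *. nra. }
  assert (hcd : 0 < c * d) by (unfold c; nra).
  destruct (Pow_x_infinity q ltac:(rewrite Rabs_pos_eq; lra) (2 * M / (c * d) + 1)) as [N hN].
  specialize (hN N (le_n N)). rewrite Rabs_pos_eq in hN by (apply pow_le; lra).
  specialize (hk N).
  assert (e : 2 * M / (c * d) * (c * d) = 2 * M)
    by (unfold Rdiv; rewrite Rmult_assoc, Rinv_l by lra; ring).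
  set (r := 2 * M / (c * d)) in *. nra.
Qed.

(** The sign lemma applied to [f] and [- f] settles the open period; the integer points follow by
    continuity. *)
Lemma no_fourier_zero (f : R -> R) :
  cont f -> periodic1 f -> no_fourier f -> forall x, f x = 0.
Proof.
  intros hf hp h.
  assert (hin : forall x, 0 < x < 1 -> f x = 0).
  { intros x hx. apply Rle_antisym; [now apply no_fourier_not_pos|].
    assert (- f x <= 0); [|lra].
    apply (no_fourier_not_pos (fun y => - f y)); [prove_cont| |assumption].
    intros n a. rewrite (mean_ext _ (fun y => - (f y * osc n a y))) by (intros; ring).
    rewrite mean_opp, h; [ring|]. prove_cont; apply cont_osc. }
  intros x. destruct (periodic1_unit_interval f x hp) as [y [hy <-]].
  destruct (Req_dec y 0) as [->|hy0]; [|apply hin; lra].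
  destruct (Req_dec (f 0) 0) as [|hne]; [assumption|exfalso].
  destruct (cont_near f 0 (Rabs (f 0)) hf (Rabs_pos_lt _ hne)) as [d [hd hn]].
  set (z := Rmin (d / 2) (/ 2)).
  assert (0 < z /\ z < d /\ z < 1).
  { unfold z; repeat split; [apply Rmin_glb_lt; lra| |].
    - eapply Rle_lt_trans; [apply Rmin_l|lra].
    - eapply Rle_lt_trans; [apply Rmin_r|lra]. }
  clearbody z. specialize (hn z).
  rewrite (hin z), Rminus_0_r, (Rabs_pos_eq z) in hn by (try split; lra).
  specialize (hn ltac:(lra)). unfold Rminus in hn. rewrite Rplus_0_l, Rabs_Ropp in hn. lra.
Qed.

(** * Differentiating Fourier series *)

Lemma near_cont (f : R -> R) :
  (forall x e, 0 < e -> exists d, 0 < d /\ forall y, Rabs (y - x) < d -> Rabs (f y - f x) < e) ->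
  cont f.
Proof.
  intros h x. apply (proj2 (filterlim_locally f (f x))). intros [e he].
  destruct (h x e he) as [d [hd hy]]. exists (mkposreal d hd). exact hy.
Qed.

Lemma zero_derivative_const (f : R -> R) :
  (forall x, is_derive f x 0) -> forall x y, f x = f y.
Proof.
  intros h x y. destruct (Rtotal_order x y) as [hxy|[->|hxy]]; [|easy|symmetry];
    (apply (eq_is_derive (V := R_NormedModule)); [intros; apply h | assumption]).
Qed.

Lemma cont_sum_f_R0 (phi : nat -> R -> R) (N : nat) :
  (forall n, cont (phi n)) -> cont (fun x => sum_f_R0 (fun n => phi n x) N).
Proof. intros h; induction N as [|N IH]; simpl; prove_cont. Qed.

Lemma series_tail_small (r : nat -> R) (e : R) (K : nat) :
  ex_series r -> 0 < e ->
  exists N, (K <= N)%nat /\ Series r - sum_f_R0 r N < e.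
Proof.
  intros hr he. destruct (proj1 (is_series_Reals r _) (Series_correct r hr) e he) as [N hN].
  exists (max K N); split; [lia|]. specialize (hN (max K N) ltac:(lia)).
  unfold Rdist in hN. apply Rabs_def2 in hN. lra.
Qed.

Lemma weierstrass_tail (phi r : nat -> R) (N : nat) :
  (forall n, Rabs (phi n) <= r n) -> ex_series r ->
  Rabs (Series phi - sum_f_R0 phi N) <= Series r - sum_f_R0 r N.
Proof.
  intros h hr.
  assert (hp : ex_series phi) by (apply (ex_series_le (V := R_CompleteNormedModule)) with r; auto).
  rewrite (Series_incr_n phi (S N)), (Series_incr_n r (S N)) by (auto; lia). simpl pred.
  match goal with |- Rabs ?a <= ?b =>
    replace a with (Series (fun k => phi (S N + k)%nat)) by ring;
    replace b with (Series (fun k => r (S N + k)%nat)) by ring end.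
  assert (hr' : ex_series (fun k => r (S N + k)%nat)) by now apply (ex_series_incr_n r (S N)).
  eapply Rle_trans; [apply Series_Rabs|apply Series_le; auto].
  - apply (ex_series_le (V := R_CompleteNormedModule)) with (2 := hr'). intros n.
    unfold norm; simpl; unfold abs; simpl. rewrite Rabs_Rabsolu. apply h.
  - intros n; split; [apply Rabs_pos|apply h].
Qed.

Lemma weierstrass_bound (phi r : nat -> R) :
  (forall n, Rabs (phi n) <= r n) -> ex_series r -> Rabs (Series phi) <= Series r.
Proof.
  intros h hr. eapply Rle_trans; [apply Series_Rabs|apply Series_le; auto].
  - apply (ex_series_le (V := R_CompleteNormedModule)) with (2 := hr). intros n.
    unfold norm; simpl; unfold abs; simpl. rewrite Rabs_Rabsolu. apply h.
  - intros n; split; [apply Rabs_pos|apply h].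
Qed.

Lemma weierstrass_cont (phi : nat -> R -> R) (r : nat -> R) :
  (forall n, cont (phi n)) -> (forall n x, Rabs (phi n x) <= r n) -> ex_series r ->
  cont (fun x => Series (fun n => phi n x)).
Proof.
  intros hc hb hr. apply near_cont. intros x e he.
  destruct (series_tail_small r (e / 3) 0 hr ltac:(lra)) as [N [_ hN]].
  destruct (cont_near _ x (e / 3) (cont_sum_f_R0 phi N hc) ltac:(lra)) as [d [hd hy]].
  exists d; split; [assumption|]. intros y hyd. specialize (hy y hyd).
  pose proof (weierstrass_tail (fun n => phi n x) r N (fun n => hb n x) hr) as h1.
  pose proof (weierstrass_tail (fun n => phi n y) r N (fun n => hb n y) hr) as h2.
  apply Rabs_le_between in h1. apply Rabs_le_between in h2.
  apply Rabs_def2 in hy. apply Rabs_def1; lra.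
Qed.

(** Partial sums beyond [K] all have the same mean against [psi], and uniform convergence passes
    this to the limit. This reads off the Fourier coefficients of a trigonometric series. *)
Lemma weierstrass_mean_single (phi : nat -> R -> R) (r : nat -> R) (psi : R -> R) (K : nat) :
  (forall n, cont (phi n)) -> (forall n x, Rabs (phi n x) <= r n) -> ex_series r -> cont psi ->
  (forall n, n <> K -> mean (fun x => phi n x * psi x) = 0) ->
  mean (fun x => Series (fun n => phi n x) * psi x) = mean (fun x => phi K x * psi x).
Proof.
  intros hc hb hr hpsi h0.
  assert (hsum : forall N, (K <= N)%nat ->
    mean (fun x => sum_f_R0 (fun n => phi n x) N * psi x) = mean (fun x => phi K x * psi x)).
  { assert (hs : forall N, mean (fun x => sum_f_R0 (fun n => phi n x) (S N) * psi x) =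
        mean (fun x => sum_f_R0 (fun n => phi n x) N * psi x) + mean (fun x => phi (S N) x * psi x)).
    { intros N. pose proof (cont_sum_f_R0 phi N hc). rewrite <- mean_plus by prove_cont.
      apply mean_ext; intros x _; simpl; ring. }
    assert (hlt : forall N, (N < K)%nat -> mean (fun x => sum_f_R0 (fun n => phi n x) N * psi x) = 0).
    { induction N as [|N IH]; intros hN; [apply h0; lia|].
      rewrite hs, IH, h0 by lia; ring. }
    induction N as [|N IH]; intros hN; [replace K with 0%nat by lia; reflexivity|].
    rewrite hs. destruct (Nat.eq_dec (S N) K) as [e|ne].
    - rewrite hlt, e by lia; ring.
    - rewrite IH, (h0 (S N)) by lia; ring. }
  pose proof (weierstrass_cont phi r hc hb hr) as hg.
  destruct (cont_bounded psi hpsi) as [M [hM hpM]].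
  apply cond_eq. intros e he.
  destruct (series_tail_small r (e / (M + 1)) K hr) as [N [hKN hN]].
  { apply Rdiv_lt_0_compat; lra. }
  rewrite <- (hsum N hKN). pose proof (cont_sum_f_R0 phi N hc) as hS.
  rewrite <- mean_minus by prove_cont.
  assert (hMe : e / (M + 1) * (M + 1) = e) by (field; lra).
  apply Rle_lt_trans with ((Series r - sum_f_R0 r N) * M).
  - apply mean_abs_le; [prove_cont|]. intros x hx.
    rewrite <- Rmult_minus_distr_r, Rabs_mult.
    apply Rmult_le_compat; try apply Rabs_pos; [|now apply hpM].
    now apply (weierstrass_tail (fun n => phi n x)).
  - assert (0 <= Series r - sum_f_R0 r N); [|nra].
    eapply Rle_trans; [apply Rabs_pos|apply (weierstrass_tail (fun n => phi n 0))]; auto.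
Qed.

Lemma no_fourier_nat (f : R -> R) :
  (forall (n : nat) a, mean (fun x => f x * osc (Z.of_nat n) a x) = 0) -> no_fourier f.
Proof.
  intros h n a. destruct (Z_le_gt_dec 0 n) as [hn|hn].
  - rewrite <- (Z2Nat.id n hn); apply h.
  - rewrite <- (h (Z.to_nat (- n)) (- a)). apply mean_ext; intros x _.
    rewrite Z2Nat.id by lia. unfold osc. rewrite <- cos_neg, opp_IZR.
    do 2 f_equal; ring.
Qed.

Lemma mean_osc_fourier (f : R -> R) (n : Z) (a : R) :
  cont f -> mean (fun x => f x * osc n a x) = cos a * fst (fourier f n) + sin a * snd (fourier f n).
Proof.
  intros hf. unfold fourier; simpl.
  change (mean (fun x => f x * osc n a x) =
    cos a * mean (fun x => f x * cos (2 * PI * IZR n * x))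
    + sin a * - mean (fun x => f x * sin (2 * PI * IZR n * x))).
  rewrite (mean_ext _ (fun x => cos a * (f x * cos (2 * PI * IZR n * x))
    - sin a * (f x * sin (2 * PI * IZR n * x)))).
  - rewrite mean_minus, !mean_scal by prove_cont; ring.
  - intros x _; unfold osc; rewrite cos_plus; ring.
Qed.

Lemma Cmod_sqr (z : C) : Cmod z ^ 2 = fst z ^ 2 + snd z ^ 2.
Proof. unfold Cmod. rewrite pow2_sqrt; [easy|]. nra. Qed.

Lemma cos_sin_le_Cmod (z : C) (a : R) : Rabs (cos a * fst z + sin a * snd z) <= Cmod z.
Proof.
  apply Rabs_le_between, Rabs_le_between.
  rewrite <- (Rabs_pos_eq (Cmod z)) by apply Cmod_ge_0. apply Rsqr_le_abs_0.
  pose proof (Cmod_sqr z) as e. pose proof (sin2_cos2 a) as p. unfold Rsqr in *.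
  replace (Cmod z * Cmod z) with (Cmod z ^ 2) by ring. rewrite e.
  (* The square is the defect in the Cauchy-Schwarz inequality, by Lagrange's identity. *)
  pose proof (pow2_ge_0 (sin a * fst z - cos a * snd z)). nra.
Qed.

Lemma mean_derivative_osc (f g : R -> R) (n : Z) (a : R) :
  periodic1 f -> (forall x, is_derive f x (g x)) -> cont g ->
  mean (fun x => g x * osc n a x)
  = - (2 * PI * IZR n * mean (fun x => f x * osc n (a + PI / 2) x)).
Proof.
  intros hp hd hg. pose proof (cont_derivative f g hd) as hf.
  pose proof (cont_osc n a). pose proof (cont_osc n (a + PI / 2)).
  assert (e : mean (fun x => g x * osc n a x
     + 2 * PI * IZR n * (f x * osc n (a + PI / 2) x)) = 0).
  { apply mean_periodic_derivative with (F := fun x => f x * osc n a x); [|prove_cont|].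
    - intros x. replace (g x * osc n a x + 2 * PI * IZR n * (f x * osc n (a + PI / 2) x))
        with (g x * osc n a x + f x * (2 * PI * IZR n * osc n (a + PI / 2) x)) by ring.
      apply (is_derive_mult f (osc n a)); [apply hd|apply is_derive_osc|].
      intros; apply Rmult_comm.
    - replace 1 with (0 + 1) by ring. now rewrite hp, osc_periodic. }
  rewrite mean_plus, mean_scal in e by prove_cont. lra.
Qed.

(** The phases [0] and [PI / 2] isolate the real and imaginary parts; integration by parts exchanges
    them up to sign and the factor [2 * PI * n]. *)
Lemma Cmod_fourier_derivative (f g : R -> R) (n : nat) :
  periodic1 f -> (forall x, is_derive f x (g x)) -> cont g ->
  Cmod (fourier g (Z.of_nat n)) = 2 * PI * INR n * Cmod (fourier f (Z.of_nat n)).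
Proof.
  intros hp hd hg. pose proof (cont_derivative f g hd) as hf.
  pose proof (fun a => mean_derivative_osc f g (Z.of_nat n) a hp hd hg) as e.
  pose proof (fun a => mean_osc_fourier f (Z.of_nat n) a hf) as ef.
  pose proof (fun a => mean_osc_fourier g (Z.of_nat n) a hg) as eg.
  rewrite <- INR_IZR_INZ in e.
  pose proof (e 0) as e0. pose proof (e (PI / 2)) as e1. rewrite eg, ef in e0, e1.
  replace (PI / 2 + PI / 2) with PI in e1 by field. rewrite Rplus_0_l in e0.
  rewrite cos_0, sin_0, cos_PI2, sin_PI2 in e0. rewrite cos_PI, sin_PI, cos_PI2, sin_PI2 in e1.
  assert (0 <= 2 * PI * INR n) by (pose proof (pos_INR n); pose proof PI_RGT_0; nra).
  rewrite <- (Rabs_pos_eq (Cmod (fourier g _))) by apply Cmod_ge_0.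
  rewrite <- (Rabs_pos_eq (2 * PI * _ * Cmod _))
    by (apply Rmult_le_pos; [assumption|apply Cmod_ge_0]).
  apply Rsqr_eq_abs_0. unfold Rsqr.
  replace (Cmod (fourier g (Z.of_nat n)) * Cmod (fourier g (Z.of_nat n)))
    with (Cmod (fourier g (Z.of_nat n)) ^ 2) by ring.
  transitivity ((2 * PI * INR n) ^ 2 * Cmod (fourier f (Z.of_nat n)) ^ 2); [|ring].
  rewrite !Cmod_sqr.
  replace (fst (fourier g (Z.of_nat n))) with (- (2 * PI * INR n * snd (fourier f (Z.of_nat n)))) by lra.
  replace (snd (fourier g (Z.of_nat n))) with (2 * PI * INR n * fst (fourier f (Z.of_nat n))) by lra.
  ring.
Qed.

(** The size of the [j]-th derivative at frequency [n + 1], up to [(2 PI)^j]. Frequency zero does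
    not contribute to derivatives, and for real [f] the negative frequencies mirror the positive
    ones. *)
Definition amplitude (j : nat) (f : R -> R) (n : nat) : R :=
  INR (S n) ^ j * Cmod (fourier f (Z.of_nat (S n))).

(** The series differentiated term by term converges uniformly to some [g] of mean zero, so its
    primitive [G] is periodic. Off frequency zero [G] and [f] have the same coefficients, hence
    [f - G] is constant by uniqueness. *)
Lemma fourier_derivative (f : R -> R) :
  cont f -> periodic1 f -> ex_series (amplitude 1 f) ->
  exists g, cont g /\ (forall x, is_derive f x (g x)) /\
    forall x, Rabs (g x) <= 4 * PI * Series (amplitude 1 f).
Proof.
  intros hf hp hs.
  set (N := fun n => Z.of_nat (S n)).
  (* The derivative of [2 Re (f^(N) e^(2 i PI N x))], the joint contribution of the frequencies [N]
     and [- N], where [f^] is the Fourier transform; hence [4 * PI]. *)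
  set (phi := fun n x => 4 * PI * INR (S n) *
     (fst (fourier f (N n)) * osc (N n) (PI / 2) x - snd (fourier f (N n)) * osc (N n) 0 x)).
  set (r := fun n => 4 * PI * amplitude 1 f n).
  pose proof PI_RGT_0 as hpi.
  assert (hphic : forall n, cont (phi n)).
  { intros n. pose proof (cont_osc (N n)). unfold phi; prove_cont. }
  assert (hr : ex_series r) by (apply (ex_series_scal (V := R_NormedModule)); exact hs).
  assert (hphi : forall n x, Rabs (phi n x) <= r n).
  { intros n x. unfold phi, r, amplitude. rewrite pow_1.
    assert (0 <= 4 * PI * INR (S n)) by (pose proof (pos_INR (S n)); nra).
    rewrite <- Rmult_assoc, Rabs_mult, Rabs_pos_eq by assumption.
    apply Rmult_le_compat_l; [assumption|].
    eapply Rle_trans; [|apply (cos_sin_le_Cmod _ (- (2 * PI * IZR (N n) * x + PI / 2)))].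
    right; apply (f_equal Rabs). unfold osc. rewrite cos_neg, sin_neg, (sin_plus _ (PI / 2)), cos_PI2, sin_PI2.
    fold (N n). rewrite Rplus_0_r; ring. }
  assert (hmphi : forall n k a, (N n + k <> 0)%Z ->
    mean (fun x => phi n x * osc k a x) = 2 * PI * INR (S n) *
      (fst (fourier f (N n)) * mean (osc (N n - k) (PI / 2 - a))
       - snd (fourier f (N n)) * mean (osc (N n - k) (0 - a)))).
  { intros n k a hnk.
    pose proof (cont_osc (N n + k)) as h1. pose proof (cont_osc (N n - k)) as h2.
    set (p := 2 * PI * INR (S n)).
    rewrite (mean_ext _ (fun x =>
      (p * fst (fourier f (N n))) * osc (N n + k) (PI / 2 + a) x
      + (p * fst (fourier f (N n))) * osc (N n - k) (PI / 2 - a) x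
      - ((p * snd (fourier f (N n))) * osc (N n + k) (0 + a) x
         + (p * snd (fourier f (N n))) * osc (N n - k) (0 - a) x))).
    - rewrite mean_minus, !mean_plus, !mean_scal by prove_cont.
      rewrite !(mean_osc (N n + k)) by assumption.
      unfold p; ring.
    - intros x _. unfold phi, p. pose proof (osc_mult (N n) k (PI / 2) a x) as e1.
      pose proof (osc_mult (N n) k 0 a x) as e2.
      transitivity (4 * PI * INR (S n) *
        (fst (fourier f (N n)) * (osc (N n) (PI / 2) x * osc k a x)
         - snd (fourier f (N n)) * (osc (N n) 0 x * osc k a x))); [ring|].
      rewrite e1, e2; field. }
  set (g := fun x => Series (fun n => phi n x)).
  assert (hg : cont g) by now apply weierstrass_cont with r.
  assert (hgp : periodic1 g).
  { intros x; apply Series_ext; intros n; unfold phi. now rewrite !osc_periodic. }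
  assert (hg0 : mean g = 0).
  { rewrite (mean_ext g (fun x => g x * osc 0 0 x)).
    2: { intros x _; unfold osc. rewrite Rmult_0_r, Rmult_0_l, Rplus_0_r, cos_0; ring. }
    assert (h0 : forall n, mean (fun x => phi n x * osc 0 0 x) = 0).
    { intros n. rewrite hmphi, !mean_osc by (unfold N; lia). ring. }
    unfold g; rewrite (weierstrass_mean_single phi r (osc 0 0) 0); auto using cont_osc. }
  assert (hgk : forall m a, mean (fun x => g x * osc (N m) a x) =
    - (2 * PI * INR (S m)) * mean (fun x => f x * osc (N m) (a + PI / 2) x)).
  { intros m a. unfold g; rewrite (weierstrass_mean_single phi r (osc (N m) a) m);
      auto using cont_osc.
    - rewrite hmphi, Z.sub_diag, !mean_osc_0, mean_osc_fourier by (unfold N; lia || assumption).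
      rewrite cos_minus, sin_plus, cos_plus, cos_PI2, sin_PI2, Rminus_0_l, cos_neg; ring.
    - intros n hn. rewrite hmphi, !mean_osc by (unfold N; lia). ring. }
  set (G := fun x => RInt g 0 x).
  assert (hG : forall x, is_derive G x (g x)).
  { intros x. apply (is_derive_RInt (V := R_NormedModule) g G 0 x); [|apply hg].
    apply filter_forall; intros y. apply (RInt_correct (V := R_CompleteNormedModule)).
    now apply cont_ex_RInt. }
  pose proof (cont_derivative G g hG) as hGc.
  assert (hGp : periodic1 G).
  { assert (hd : forall x, is_derive (fun y => G (y + 1) - G y) x 0).
    { intros x. replace 0 with (1 * g (x + 1) - g x) by (rewrite hgp; ring).
      apply (is_derive_minus (V := R_NormedModule) (fun y => G (y + 1))); [|apply hG].
      apply (is_derive_comp G (fun y => y + 1)); [apply hG|auto_derive; [easy|ring]]. }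
    intros x. pose proof (zero_derivative_const _ hd x 0) as e. cbv beta in e.
    rewrite Rplus_0_l in e.
    assert (e1 : G 1 = 0) by exact hg0.
    assert (e0 : G 0 = 0) by exact (RInt_point (V := R_CompleteNormedModule) 0 g).
    lra. }
  (* Chosen to match the coefficient at frequency zero, which the derivative does not determine. *)
  set (c := mean f - mean G).
  assert (hfG : forall x, f x - G x - c = 0).
  { apply no_fourier_zero; [prove_cont| |].
    { intros x. now rewrite hp, hGp. }
    apply no_fourier_nat. intros n a. pose proof (cont_osc (Z.of_nat n) a) as ho.
    rewrite (mean_ext _ (fun x => f x * osc (Z.of_nat n) a x - G x * osc (Z.of_nat n) a x
      - c * osc (Z.of_nat n) a x)) by (intros; ring).
    rewrite !mean_minus, mean_scal by prove_cont.
    destruct n as [|m].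
    - change (Z.of_nat 0) with 0%Z in *. rewrite mean_osc_0.
      assert (e : forall h, cont h -> mean (fun x => h x * osc 0 a x) = cos a * mean h).
      { intros h hh. rewrite <- mean_scal by assumption. apply mean_ext; intros x _.
        unfold osc. rewrite Rmult_0_r, Rmult_0_l, Rplus_0_l; ring. }
      rewrite !e by assumption. unfold c; ring.
    - fold (N m) in *. rewrite mean_osc by (unfold N; lia).
      pose proof (hgk m (a - PI / 2)) as e1.
      pose proof (mean_derivative_osc G g (N m) (a - PI / 2) hGp hG hg) as e2.
      replace (a - PI / 2 + PI / 2) with a in e1, e2 by ring.
      replace (IZR (N m)) with (INR (S m)) in e2 by apply INR_IZR_INZ.
      assert (hm : 0 < 2 * PI * INR (S m)).
      { pose proof (lt_0_INR (S m) ltac:(lia)). nra. }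
      rewrite e1 in e2.
      apply Rmult_eq_reg_l with (2 * PI * INR (S m)); [|lra]. lra. }
  exists g; split; [assumption|split].
  - intros x. apply (is_derive_ext (fun y => G y + c)).
    + intros y. specialize (hfG y). lra.
    + replace (g x) with (g x + 0) by ring.
      apply (is_derive_plus (V := R_NormedModule) G (fun _ => c)); [apply hG|].
      apply (is_derive_const (V := R_NormedModule)).
  - intros x. unfold r in *. rewrite <- Series_scal_l. now apply weierstrass_bound.
Qed.

(** * Sobolev embedding *)

Lemma Series_nonneg (a : nat -> R) : (forall n, 0 <= a n) -> ex_series a -> 0 <= Series a.
Proof.
  intros h ha. replace 0 with (Series (fun n => 0 * a n)) by (rewrite Series_scal_l; ring).
  apply Series_le; [|assumption]. intros n; specialize (h n); lra.
Qed.

(* Bounds the terms of the p-series by those of a telescoping one. *)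
Lemma Rpower_telescope (b x : R) :
  0 < b -> 0 < x -> Rpower (x + 1) (- (1 + b)) <= (Rpower x (- b) - Rpower (x + 1) (- b)) / b.
Proof.
  intros hb hx.
  destruct (MVT_gen (fun y => Rpower y (- b)) x (x + 1) (fun y => - b * Rpower y (- b - 1)))
    as [c [hc e]].
  - intros y hy. rewrite Rmin_left, Rmax_right in hy by lra.
    apply is_derive_Reals, derivable_pt_lim_power; lra.
  - intros y hy. rewrite Rmin_left, Rmax_right in hy by lra.
    apply derivable_continuous_pt. exists (- b * Rpower y (- b - 1)).
    apply derivable_pt_lim_power; lra.
  - rewrite Rmin_left, Rmax_right in hc by lra.
    replace (Rpower x (- b) - Rpower (x + 1) (- b)) with (b * Rpower c (- (1 + b))).
    + assert (h : Rpower (x + 1) (- (1 + b)) <= Rpower c (- (1 + b))).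
      { rewrite !Rpower_Ropp. apply Rinv_le_contravar; [apply exp_pos|].
        apply Rle_Rpower_l; lra. }
      apply Rle_trans with (1 := h). right; field; lra.
    + replace (- (1 + b)) with (- b - 1) by ring. lra.
Qed.

Lemma ex_series_Rpower (b : R) : 0 < b -> ex_series (fun n => Rpower (INR (S n)) (- (1 + b))).
Proof.
  intros hb.
  assert (hpos : forall x y, 0 < Rpower x y) by (intros; apply exp_pos).
  assert (hbound : forall n, sum_n (fun n => Rpower (INR (S n)) (- (1 + b))) n
    <= 1 + (1 - Rpower (INR (S n)) (- b)) / b).
  { induction n as [|n IH].
    - rewrite sum_O. replace (INR 1) with 1 by reflexivity. unfold Rpower.
      rewrite ln_1, !Rmult_0_r, exp_0. unfold Rdiv; lra.
    - rewrite sum_Sn. unfold plus; simpl plus. rewrite (S_INR (S n)).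
      pose proof (Rpower_telescope b (INR (S n)) hb (lt_0_INR (S n) ltac:(lia))) as h.
      unfold Rdiv in *. unfold plus in *; simpl in *. lra. }
  destruct (ex_finite_lim_seq_incr (sum_n (fun n => Rpower (INR (S n)) (- (1 + b)))) (1 + / b))
    as [l hl].
  - intros n. rewrite sum_Sn. unfold plus; simpl. pose proof (hpos (INR (S (S n))) (- (1 + b))).
    simpl in *; lra.
  - intros n. apply Rle_trans with (1 := hbound n).
    assert (0 <= Rpower (INR (S n)) (- b) * / b).
    { apply Rmult_le_pos; [apply Rlt_le, hpos|apply Rlt_le, Rinv_0_lt_compat, hb]. }
    unfold Rdiv. lra.
  - exists l. exact hl.
Qed.

Lemma Hs_weighted_nonneg (s : R) (f : R -> R) (n : Z) : 0 <= Hs_weighted s f n.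
Proof. apply Rmult_le_pos; [apply Rlt_le, exp_pos|apply pow2_ge_0]. Qed.

Lemma Hs_terms_nonneg (s : R) (f : R -> R) (n : nat) : 0 <= Hs_terms s f n.
Proof. apply Rplus_le_le_0_compat; apply Hs_weighted_nonneg. Qed.

Lemma Hs_weighted_opp (s : R) (f : R -> R) (n : Z) :
  cont f -> Hs_weighted s f (- n) = Hs_weighted s f n.
Proof.
  intros hf. unfold Hs_weighted. rewrite opp_IZR. f_equal; [f_equal; ring|].
  rewrite !Cmod_sqr. unfold fourier; simpl.
  rewrite (RInt_ext _ (fun x => f x * cos (2 * PI * IZR n * x)))
    by (intros x _; rewrite opp_IZR, <- (cos_neg (2 * PI * IZR n * x)); do 2 f_equal; ring).
  rewrite (RInt_ext (fun x => f x * sin (2 * PI * IZR (- n) * x))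
    (fun x => - (f x * sin (2 * PI * IZR n * x)))).
  2: { intros x _. rewrite opp_IZR, Ropp_mult_distr_r, <- sin_neg. do 2 f_equal; ring. }
  fold (mean (fun x => - (f x * sin (2 * PI * IZR n * x)))).
  rewrite mean_opp by prove_cont. unfold mean; ring.
Qed.

(** Cauchy-Schwarz for the sum of the amplitudes, done term by term as
    [y a <= l w a^2 + y^2 / (l w)] with [y = x^j], [w = (1 + x^2)^s] at frequency [x]. The weight
    [l] stays free in order to be tuned to the norm later. The exponent [2 (s - j)] is written
    [1 + b] to fit the p-series. *)
Lemma amplitude_le (j : nat) (s l : R) (f : R -> R) (n : nat) :
  cont f -> INR j < s -> 0 < l ->
  amplitude j f n <= l * Hs_terms s f n + / l * Rpower (INR (S n)) (- (1 + (2 * (s - INR j) - 1))).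
Proof.
  intros hf hs hl.
  assert (hx : 1 <= INR (S n)) by (rewrite S_INR; pose proof (pos_INR n); lra).
  unfold amplitude.
  set (a := Cmod (fourier f (Z.of_nat (S n)))).
  set (w := Rpower (1 + INR (S n) ^ 2) s).
  assert (hw : 0 < w) by apply exp_pos.
  assert (h1 : w * a ^ 2 <= Hs_terms s f n).
  { unfold Hs_terms. rewrite Hs_weighted_opp by assumption.
    pose proof (Hs_weighted_nonneg s f (Z.of_nat n)).
    assert (e : Hs_weighted s f (Z.of_nat (S n)) = w * a ^ 2); [|lra].
    unfold Hs_weighted, w. now rewrite INR_IZR_INZ. }
  set (x := INR (S n)) in *.
  set (c := s - INR j).
  assert (h2 : (x ^ j) ^ 2 / w <= Rpower x (- (1 + (2 * c - 1)))).
  { assert (hw' : w = (1 + x ^ 2) ^ j * Rpower (1 + x ^ 2) c).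
    { rewrite <- Rpower_pow by nra. rewrite <- Rpower_plus. unfold w, c. f_equal; ring. }
    replace (- (1 + (2 * c - 1))) with (- (2 * c)) by ring.
    rewrite Rpower_Ropp, <- Rpower_mult. replace (Rpower x 2) with (x ^ 2).
    2: { replace 2 with (INR 2) by reflexivity. now rewrite Rpower_pow by lra. }
    assert (hc : 0 < Rpower (x ^ 2) c) by apply exp_pos.
    assert (hc' : Rpower (x ^ 2) c <= Rpower (1 + x ^ 2) c)
      by (apply Rle_Rpower_l; unfold c; nra).
    assert (hj : (x ^ j) ^ 2 <= (1 + x ^ 2) ^ j).
    { rewrite <- pow_mult, Nat.mul_comm, pow_mult. apply pow_incr; nra. }
    assert (hj0 : 0 < (1 + x ^ 2) ^ j) by (apply pow_lt; nra).
    apply Rmult_le_reg_r with w; [assumption|]. unfold Rdiv.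
    rewrite Rmult_assoc, Rinv_l, Rmult_1_r by lra. rewrite hw'.
    apply Rmult_le_reg_l with (Rpower (x ^ 2) c); [assumption|].
    rewrite <- (Rmult_assoc _ (/ _)), Rinv_r, Rmult_1_l by lra.
    rewrite Rmult_comm. apply Rmult_le_compat; try lra. apply pow2_ge_0. }
  apply Rle_trans with (l * (w * a ^ 2) + / l * ((x ^ j) ^ 2 / w)).
  - (* AM-GM *)
    set (y := x ^ j).
    apply Rmult_le_reg_l with (l * w); [nra|].
    replace (l * w * (l * (w * a ^ 2) + / l * (y ^ 2 / w))) with ((l * w * a) ^ 2 + y ^ 2)
      by (field; lra).
    pose proof (pow2_ge_0 (l * w * a - y)). pose proof (pow2_ge_0 (l * w * a)).
    pose proof (pow2_ge_0 y). nra.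
  - apply Rplus_le_compat; apply Rmult_le_compat_l; try lra.
    apply Rlt_le, Rinv_0_lt_compat, hl.
Qed.

(** [K] is the sum of the p-series of exponent [2 (s - j) > 1]; it depends on neither [f] nor
    [l]. *)
Lemma amplitude_summable (j : nat) (s : R) :
  INR j + / 2 < s ->
  exists K, 0 <= K /\ forall f l, Hs s f -> 0 < l ->
    ex_series (amplitude j f) /\ Series (amplitude j f) <= l * Series (Hs_terms s f) + / l * K.
Proof.
  intros hs. set (p := fun n => Rpower (INR (S n)) (- (1 + (2 * (s - INR j) - 1)))).
  assert (hp : ex_series p) by (apply ex_series_Rpower; lra).
  exists (Series p); split.
  { apply Series_nonneg; [intros n; apply Rlt_le, exp_pos|assumption]. }
  intros f l [_ [hf hsum]] hl.
  assert (hle : forall n, 0 <= amplitude j f n <= l * Hs_terms s f n + / l * p n).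
  { intros n; split.
    - apply Rmult_le_pos; [apply pow_le, pos_INR|apply Cmod_ge_0].
    - apply amplitude_le; auto. lra. }
  assert (h1 : ex_series (fun n => l * Hs_terms s f n))
    by (apply (ex_series_scal (V := R_NormedModule)); assumption).
  assert (h2 : ex_series (fun n => / l * p n))
    by (apply (ex_series_scal (V := R_NormedModule)); assumption).
  assert (h : ex_series (fun n => l * Hs_terms s f n + / l * p n))
    by (apply (ex_series_plus (V := R_NormedModule)); assumption).
  split.
  - apply (ex_series_le (V := R_CompleteNormedModule)) with (2 := h). intros n.
    destruct (hle n). unfold norm; simpl; unfold abs; simpl. now rewrite Rabs_pos_eq.
  - rewrite <- !Series_scal_l, <- Series_plus by assumption. now apply Series_le.
Qed.

Lemma Series_Hs_terms_le (s e : R) (f : R -> R) :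
  Hs_norm s f <= e -> Series (Hs_terms s f) <= e ^ 2.
Proof.
  intros he. unfold Hs_norm in he. destruct (Rle_or_lt 0 (Series (Hs_terms s f))) as [h|h].
  - rewrite <- (pow2_sqrt _ h). pose proof (sqrt_pos (Series (Hs_terms s f))).
    apply pow_incr; lra.
  - pose proof (pow2_ge_0 e); lra.
Qed.

(** The choice [l = / e] turns [l e^2 + K / l] into [(1 + K) e], a bound linear in the norm. A
    positive upper bound [e] stands in for the norm itself, which may vanish and could not be
    inverted. *)
Lemma Hs_derivative (s : R) :
  3 / 2 < s ->
  exists K, 0 < K /\ forall f, Hs s f ->
    exists g, cont g /\ (forall x, is_derive f x (g x)) /\
      forall e, 0 < e -> Hs_norm s f <= e -> forall x, Rabs (g x) <= K * e.
Proof.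
  intros hs. destruct (amplitude_summable 1 s) as [K [hK hamp]]; [simpl; lra|].
  pose proof PI_RGT_0 as hpi.
  exists (4 * PI * (1 + K)); split; [nra|]. intros f hf.
  destruct (fourier_derivative f) as [g [hg [hd hb]]].
  - exact (proj1 (proj2 hf)).
  - exact (proj1 hf).
  - apply (hamp f 1 hf); lra.
  - exists g; split; [assumption|split; [assumption|]].
    intros e he hn x. apply Rle_trans with (1 := hb x).
    rewrite (Rmult_assoc _ (1 + K)). apply Rmult_le_compat_l; [nra|].
    destruct (hamp f (/ e) hf (Rinv_0_lt_compat _ he)) as [_ h].
    apply Rle_trans with (1 := h). apply Series_Hs_terms_le in hn. rewrite Rinv_inv.
    assert (/ e * Series (Hs_terms s f) <= / e * e ^ 2)
      by (apply Rmult_le_compat_l; [apply Rlt_le, Rinv_0_lt_compat, he|assumption]).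
    replace (/ e * e ^ 2) with e in H by (field; lra). lra.
Qed.

(** The first-order amplitudes of [g] are [2 * PI] times the second-order ones of [f], so the
    termwise differentiation applies to [g] directly. *)
Lemma Hs_derivative2 (s : R) (f g : R -> R) :
  5 / 2 < s -> Hs s f -> (forall x, is_derive f x (g x)) -> cont g ->
  exists h, cont h /\ forall x, is_derive g x (h x).
Proof.
  intros hs hf hd hg. destruct hf as [hp [hc hsum]].
  destruct (amplitude_summable 2 s) as [K [_ hamp]]; [simpl; lra|].
  destruct (fourier_derivative g) as [h [hh [hdh _]]]; [assumption| | |eauto].
  - now apply derivative_periodic with f.
  - apply ex_series_ext with (fun n => 2 * PI * amplitude 2 f n).
    + intros n. unfold amplitude. rewrite (Cmod_fourier_derivative f g) by assumption.
      unfold scal; simpl; ring.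
    + apply (ex_series_scal (V := R_NormedModule)).
      apply (hamp f 1); [now split|lra].
Qed.

(** The square of the mean is bounded by the term at frequency zero, whose weight is 1. *)
Lemma Hs_mean (s e : R) (f : R -> R) : Hs s f -> 0 <= e -> Hs_norm s f <= e -> Rabs (mean f) <= e.
Proof.
  intros [_ [hf hsum]] he hn. apply Series_Hs_terms_le in hn.
  assert (h0 : mean f ^ 2 <= Series (Hs_terms s f)).
  { rewrite (Series_incr_1 _ hsum).
    assert (0 <= Series (fun k => Hs_terms s f (S k))).
    { apply Series_nonneg; [intros; apply Hs_terms_nonneg|]. now apply (ex_series_incr_1 (Hs_terms s f)). }
    assert (mean f ^ 2 <= Hs_terms s f 0); [|lra].
    unfold Hs_terms. pose proof (Hs_weighted_nonneg s f (- Z.of_nat 1)).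
    assert (mean f ^ 2 <= Hs_weighted s f (Z.of_nat 0)); [|lra].
    unfold Hs_weighted. rewrite Cmod_sqr. simpl Z.of_nat.
    replace (Rpower (1 + 0 ^ 2) s) with 1.
    2: { unfold Rpower. replace (1 + 0 ^ 2) with 1 by ring. now rewrite ln_1, Rmult_0_r, exp_0. }
    replace (fst (fourier f 0)) with (mean f).
    - pose proof (pow2_ge_0 (snd (fourier f 0))). lra.
    - apply mean_ext; intros x _. rewrite Rmult_0_r, Rmult_0_l, cos_0; ring. }
  rewrite <- (Rabs_pos_eq e) by assumption. apply Rsqr_le_abs_0. unfold Rsqr. lra.
Qed.

(** Follows from [|a p + b q|^2 <= 2 a^2 |p|^2 + 2 b^2 |q|^2] on coefficients. It makes the
    embedding applicable to increments and difference quotients in time. *)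
Lemma Hs_linear (s a b : R) (f g : R -> R) :
  Hs s f -> Hs s g -> Hs s (fun x => a * f x + b * g x).
Proof.
  intros [hpf [hf hsf]] [hpg [hg hsg]]. repeat split.
  - intros x. now rewrite hpf, hpg.
  - change (cont (fun x => a * f x + b * g x)). change (cont f) in hf. change (cont g) in hg.
    prove_cont.
  - change (cont f) in hf. change (cont g) in hg.
    assert (hF : forall n, fourier (fun x => a * f x + b * g x) n =
      (a * fst (fourier f n) + b * fst (fourier g n), a * snd (fourier f n) + b * snd (fourier g n))).
    { intros n.
      assert (h : forall q, cont q -> mean (fun x => (a * f x + b * g x) * q x)
                = a * mean (fun x => f x * q x) + b * mean (fun x => g x * q x)).
      { intros q hq. rewrite <- !mean_scal, <- mean_plus by prove_cont.
        apply mean_ext; intros; ring. }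
      unfold fourier; cbn [fst snd]. f_equal.
      - apply (h (fun x => cos (2 * PI * IZR n * x))); prove_cont.
      - transitivity (- (a * mean (fun x => f x * sin (2 * PI * IZR n * x))
          + b * mean (fun x => g x * sin (2 * PI * IZR n * x)))); [|unfold mean; ring].
        f_equal. apply (h (fun x => sin (2 * PI * IZR n * x))); prove_cont. }
    assert (hw : forall n, Hs_weighted s (fun x => a * f x + b * g x) n <=
      2 * a ^ 2 * Hs_weighted s f n + 2 * b ^ 2 * Hs_weighted s g n).
    { intros n. unfold Hs_weighted. rewrite hF, !Cmod_sqr; cbn [fst snd].
      set (w := Rpower (1 + IZR n ^ 2) s). assert (0 < w) by apply exp_pos.
      destruct (fourier f n) as [p q], (fourier g n) as [p' q']; cbn [fst snd].
      pose proof (Rmult_le_pos w _ (Rlt_le _ _ H) (pow2_ge_0 (a * p - b * p'))).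
      pose proof (Rmult_le_pos w _ (Rlt_le _ _ H) (pow2_ge_0 (a * q - b * q'))). lra. }
    apply (ex_series_le (V := R_CompleteNormedModule))
      with (b := fun n => 2 * a ^ 2 * Hs_terms s f n + 2 * b ^ 2 * Hs_terms s g n).
    + intros n. unfold norm; simpl; unfold abs; simpl.
      rewrite Rabs_pos_eq by apply Hs_terms_nonneg. unfold Hs_terms.
      pose proof (hw (Z.of_nat n)) as h1. pose proof (hw (- Z.of_nat (S n))%Z) as h2.
      simpl in *. lra.
    + apply (ex_series_plus (V := R_NormedModule)); apply (ex_series_scal (V := R_NormedModule));
        assumption.
Qed.

(** * The evolution of [u_x] *)

(** A discriminant argument: the mean of [(l f + osc)^2] is nonnegative for all [l], but without a
    positive quadratic term in [l] this forces the linear coefficient [2 q] to vanish. *)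
Lemma mean_sqr_zero (f : R -> R) :
  cont f -> periodic1 f -> mean (fun x => f x * f x) <= 0 -> forall x, f x = 0.
Proof.
  intros hf hp h0. apply no_fourier_zero; auto. intros n a.
  set (q := mean (fun x => f x * osc n a x)).
  set (p := mean (fun x => osc n a x * osc n a x)).
  destruct (Req_dec q 0) as [|hq]; [assumption|exfalso].
  (* Makes the affine part [2 l q + p] equal to [-1]. *)
  set (l := - (p + 1) / (2 * q)).
  assert (h : 0 <= mean (fun x => (l * f x + osc n a x) * (l * f x + osc n a x))).
  { rewrite <- (mean_const 0). apply mean_le; try prove_cont.
    intros x _. apply Rle_0_sqr. }
  rewrite (mean_ext _ (fun x => l ^ 2 * (f x * f x) + 2 * l * (f x * osc n a x)
    + osc n a x * osc n a x)) in h by (intros; ring).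
  rewrite !mean_plus, !mean_scal in h by prove_cont. fold q p in h.
  assert (e : 2 * l * q = - (p + 1)) by (unfold l; field; assumption).
  pose proof (pow2_ge_0 l). nra.
Qed.

Lemma Derive_n_osc (n : Z) (a : R) (k : nat) (x : R) :
  Derive_n (osc n a) k x = (2 * PI * IZR n) ^ k * osc n (a + INR k * (PI / 2)) x.
Proof.
  revert x; induction k as [|k IH]; intros x.
  - simpl. rewrite Rmult_1_l. f_equal; ring.
  - simpl Derive_n. rewrite (Derive_ext _ _ x IH). apply is_derive_unique.
    replace (a + INR (S k) * (PI / 2)) with (a + INR k * (PI / 2) + PI / 2)
      by (rewrite S_INR; ring).
    simpl pow. rewrite (Rmult_comm (2 * PI * IZR n)), (Rmult_assoc (_ ^ k)).
    apply is_derive_scal, is_derive_osc.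
Qed.

Lemma test_function_osc (n : Z) (a : R) : test_function (osc n a).
Proof.
  split; [apply osc_periodic|]. intros [|k] x; simpl; [easy|].
  exists ((2 * PI * IZR n) ^ k * (2 * PI * IZR n * osc n (a + INR k * (PI / 2) + PI / 2) x)).
  apply (is_derive_ext (fun y => (2 * PI * IZR n) ^ k * osc n (a + INR k * (PI / 2)) y)).
  - intros y; symmetry; apply Derive_n_osc.
  - apply is_derive_scal, is_derive_osc.
Qed.

(** * Differentiation in time, uniformly in space *)

(** Differentiability at [t] of a curve in [C([0,1])] with the supremum norm. The remainder is
    stated without division, so that [tau = t] needs no exception. *)
Definition unif_derivative (V : R -> R -> R) (t : R) (W : R -> R) : Prop :=
  cont W /\
  (exists d, 0 < d /\ forall tau, Rabs (tau - t) < d -> cont (V tau)) /\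
  forall e, 0 < e -> exists d, 0 < d /\ forall tau, Rabs (tau - t) < d ->
    forall x, 0 <= x <= 1 -> Rabs (V tau x - V t x - (tau - t) * W x) <= e * Rabs (tau - t).

Lemma unif_derivative_const (f : R -> R) (t : R) :
  cont f -> unif_derivative (fun _ => f) t (fun _ => 0).
Proof.
  intros hf. split; [prove_cont|split].
  - exists 1; split; [lra|easy].
  - intros e he. exists 1; split; [lra|]. intros tau _ x _.
    replace (f x - f x - (tau - t) * 0) with 0 by ring. rewrite Rabs_R0.
    pose proof (Rabs_pos (tau - t)); nra.
Qed.

Lemma unif_derivative_cont (V : R -> R -> R) (t : R) (W : R -> R) :
  unif_derivative V t W -> cont (V t).
Proof.
  intros [_ [[d [hd h]] _]]. apply h. rewrite Rminus_diag, Rabs_R0; assumption.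
Qed.

Lemma unif_derivative_mult (V1 V2 : R -> R -> R) (t : R) (W1 W2 : R -> R) :
  unif_derivative V1 t W1 -> unif_derivative V2 t W2 ->
  unif_derivative (fun tau x => V1 tau x * V2 tau x) t (fun x => W1 x * V2 t x + V1 t x * W2 x).
Proof.
  intros h1 h2. pose proof (unif_derivative_cont _ _ _ h1) as c1.
  pose proof (unif_derivative_cont _ _ _ h2) as c2.
  destruct h1 as [w1 [[d1 [hd1 hc1]] h1]], h2 as [w2 [[d2 [hd2 hc2]] h2]].
  split; [prove_cont|split].
  { exists (Rmin d1 d2); split; [now apply Rmin_glb_lt|]. intros tau ht.
    assert (cont (V1 tau)) by (apply hc1; eapply Rlt_le_trans; [exact ht|apply Rmin_l]).
    assert (cont (V2 tau)) by (apply hc2; eapply Rlt_le_trans; [exact ht|apply Rmin_r]).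
    prove_cont. }
  intros e he.
  destruct (cont_bounded _ c1) as [A [hA bA]], (cont_bounded _ c2) as [B [hB bB]].
  destruct (cont_bounded _ w1) as [C [hC bC]], (cont_bounded _ w2) as [D [hD bD]].
  (* The sum of the constants of the six terms of the remainder below. With accuracy [r] for both
     factors and [|h| <= r <= 1], each term is at most its constant times [r |h|]. *)
  set (S := A + B + C + D + C * D + 1).
  assert (hS : 0 < S) by (unfold S; nra).
  set (r := Rmin 1 (e / S)).
  assert (hr : 0 < r <= 1 /\ r * S <= e).
  { unfold r; split; [split; [apply Rmin_glb_lt; [lra|now apply Rdiv_lt_0_compat]|apply Rmin_l]|].
    apply Rle_trans with (e / S * S); [|right; field; lra].
    apply Rmult_le_compat_r; [lra|apply Rmin_r]. }
  clearbody r. destruct hr as [[hr hr1] hrS].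
  destruct (h1 r hr) as [m1 [hm1 k1]], (h2 r hr) as [m2 [hm2 k2]].
  exists (Rmin r (Rmin m1 m2)); split; [repeat apply Rmin_glb_lt; assumption|].
  intros tau ht x hx.
  assert (t0 : Rabs (tau - t) < r) by (eapply Rlt_le_trans; [exact ht|apply Rmin_l]).
  assert (t1 : Rabs (tau - t) < m1)
    by (eapply Rlt_le_trans; [exact ht|eapply Rle_trans; [apply Rmin_r|apply Rmin_l]]).
  assert (t2 : Rabs (tau - t) < m2)
    by (eapply Rlt_le_trans; [exact ht|eapply Rle_trans; [apply Rmin_r|apply Rmin_r]]).
  specialize (k1 tau t1 x hx). specialize (k2 tau t2 x hx).
  specialize (bA x hx). specialize (bB x hx). specialize (bC x hx). specialize (bD x hx).
  set (h := tau - t) in *. set (a := V1 tau x - V1 t x - h * W1 x) in *.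
  set (b := V2 tau x - V2 t x - h * W2 x) in *.
  replace (V1 tau x * V2 tau x - V1 t x * V2 t x - h * (W1 x * V2 t x + V1 t x * W2 x))
    with (V1 t x * b + (a * V2 t x + (h * (h * (W1 x * W2 x))
          + (h * (W1 x * b) + (h * (W2 x * a) + a * b))))) by (unfold a, b; ring).
  pose proof (Rabs_pos h) as hh.
  assert (M : forall p q P Q, Rabs p <= P -> Rabs q <= Q -> Rabs (p * q) <= P * Q).
  { intros p q P Q hp hq. rewrite Rabs_mult. apply Rmult_le_compat; auto using Rabs_pos. }
  assert (T : forall p q P Q, Rabs p <= P -> Rabs q <= Q -> Rabs (p + q) <= P + Q).
  { intros p q P Q hp hq. eapply Rle_trans; [apply Rabs_triang|lra]. }
  assert (hr' : Rabs h <= r) by lra. assert (a1 : Rabs a <= r) by nra.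
  apply Rle_trans with (A * (r * Rabs h) + (r * Rabs h * B + (Rabs h * (r * (C * D))
     + (Rabs h * (C * r) + (Rabs h * (D * r) + r * (r * Rabs h)))))).
  - repeat (apply T || apply M); try assumption; try lra. nra.
  - apply Rle_trans with (r * S * Rabs h); [|now apply Rmult_le_compat_r].
    unfold S. assert (r * (r * Rabs h) <= 1 * (r * Rabs h)) by (apply Rmult_le_compat_r; nra).
    lra.
Qed.

Lemma is_derive_mean (V : R -> R -> R) (t : R) (W : R -> R) :
  unif_derivative V t W -> is_derive (fun tau => mean (V tau)) t (mean W).
Proof.
  intros h. pose proof (unif_derivative_cont _ _ _ h) as hVt.
  destruct h as [hW [[d [hd hc]] h]]. apply is_derive_Reals. intros e he.
  destruct (h (e / 2) ltac:(lra)) as [m [hm k]].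
  exists (mkposreal (Rmin d m) (Rmin_glb_lt _ _ _ hd hm)). simpl. intros q hq hqm.
  assert (q1 : Rabs (t + q - t) < d)
    by (replace (t + q - t) with q by ring; eapply Rlt_le_trans; [exact hqm|apply Rmin_l]).
  assert (q2 : Rabs (t + q - t) < m)
    by (replace (t + q - t) with q by ring; eapply Rlt_le_trans; [exact hqm|apply Rmin_r]).
  pose proof (hc _ q1) as hVq. specialize (k _ q2). replace (t + q - t) with q in k by ring.
  replace ((mean (V (t + q)) - mean (V t)) / q - mean W)
    with ((mean (V (t + q)) - mean (V t) - q * mean W) / q) by (field; assumption).
  rewrite <- mean_scal, <- !mean_minus by prove_cont.
  assert (hb : Rabs (mean (fun x => V (t + q) x - V t x - q * W x)) <= e / 2 * Rabs q)
    by (apply mean_abs_le; [prove_cont|exact k]).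
  pose proof (Rabs_pos_lt q hq) as hq0.
  unfold Rdiv. rewrite Rabs_mult, Rabs_inv.
  apply Rle_lt_trans with (e / 2 * Rabs q * / Rabs q).
  - apply Rmult_le_compat_r; [apply Rlt_le, Rinv_0_lt_compat, hq0|assumption].
  - rewrite Rmult_assoc, Rinv_r by lra. lra.
Qed.

(* [atan y] would decrease at a rate at least [c] forever. *)
Lemma riccati_no_global (c : R) (y y' : R -> R) :
  0 < c ->
  (forall t, 0 < t -> is_derive y t (y' t) /\ y' t <= - c * (1 + y t ^ 2)) -> False.
Proof.
  intros hc h. assert (h4 : 0 < 4 / c) by (apply Rdiv_lt_0_compat; lra).
  assert (hd : forall t, 0 < t -> is_derive (fun t => atan (y t)) t (y' t * / (1 + (y t)²))).
  { intros t ht. apply (is_derive_comp atan y); [apply is_derive_atan|now apply h]. }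
  (* Over a time [4 / c] the arctangent drops by at least 4, while its range has width [PI <= 4] and
     excludes its endpoints. *)
  destruct (MVT_gen (fun t => atan (y t)) 1 (1 + 4 / c) (fun t => y' t * / (1 + (y t)²)))
    as [x [hx e]].
  - intros x hx. rewrite Rmin_left, Rmax_right in hx by lra. apply hd; lra.
  - intros x hx. rewrite Rmin_left, Rmax_right in hx by lra.
    apply derivable_continuous_pt. eexists. apply is_derive_Reals, hd; lra.
  - rewrite Rmin_left, Rmax_right in hx by lra. destruct (h x ltac:(lra)) as [_ hx'].
    replace (1 + 4 / c - 1) with (4 / c) in e by ring.
    assert (hy : 0 < 1 + (y x)²) by (unfold Rsqr; nra).
    assert (y' x * / (1 + (y x)²) <= - c).
    { apply Rmult_le_reg_r with (1 + (y x)²); [assumption|].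
      rewrite Rmult_assoc, Rinv_l, Rmult_1_r by lra. unfold Rsqr in *; nra. }
    assert (y' x * / (1 + (y x)²) * (4 / c) <= - c * (4 / c)) by (apply Rmult_le_compat_r; lra).
    replace (- c * (4 / c)) with (-4) in H0 by (field; lra).
    pose proof (atan_bound (y (1 + 4 / c))). pose proof (atan_bound (y 1)).
    pose proof PI_4. lra.
Qed.

(** * Moments of [u_x] and the integrated equation *)

Lemma momentum_eq (U V W : R -> R) (x : R) :
  (forall x, is_derive U x (V x)) -> (forall x, is_derive V x (W x)) ->
  momentum U x = mean U - W x.
Proof.
  intros hV hW. unfold momentum. change (Derive_n U 2 x) with (Derive (Derive U) x).
  rewrite (Derive_ext (Derive U) V x) by (intros y; now apply is_derive_unique).
  now rewrite (is_derive_unique V x (W x)).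
Qed.

Lemma periodic1_10 (f : R -> R) : periodic1 f -> f 1 = f 0.
Proof. intros h. rewrite <- (h 0). f_equal; ring. Qed.

(** An exact derivative, of [V^(j+1) / (j+1)]. With [j + 2] in place of [j] it removes the cubic
    term from the [j]-th moment. *)
Lemma mean_power_derivative (V W : R -> R) (j : nat) :
  periodic1 V -> (forall x, is_derive V x (W x)) -> cont W ->
  mean (fun x => V x ^ j * W x) = 0.
Proof.
  intros hp hVW hW. pose proof (cont_derivative V W hVW) as cV.
  assert (h : mean (fun x => INR (S j) * (V x ^ j * W x)) = 0).
  { apply mean_periodic_derivative with (F := fun x => V x ^ (S j)).
    - intros x. replace (INR (S j) * (V x ^ j * W x)) with (INR (S j) * W x * V x ^ j) by ring.
      apply (is_derive_pow V (S j)), hVW.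
    - prove_cont.
    - now rewrite (periodic1_10 V hp). }
  rewrite mean_scal in h by prove_cont.
  apply Rmult_integral in h. destruct h as [h|h]; [|assumption].
  pose proof (lt_0_INR (S j) ltac:(lia)). lra.
Qed.

(** Integration by parts, from the derivative of [U V^(j+1)]; it eliminates [U] from the moments. *)
Lemma mean_product_derivative (U V W : R -> R) (j : nat) :
  periodic1 U -> periodic1 V ->
  (forall x, is_derive U x (V x)) -> (forall x, is_derive V x (W x)) -> cont W ->
  INR (S j) * mean (fun x => U x * (V x ^ j * W x)) = - mean (fun x => V x ^ S (S j)).
Proof.
  intros hU hV hUV hVW hW.
  pose proof (cont_derivative U V hUV) as cU. pose proof (cont_derivative V W hVW) as cV.
  assert (h : mean (fun x => V x ^ S (S j) + INR (S j) * (U x * (V x ^ j * W x))) = 0).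
  { apply mean_periodic_derivative with (F := fun x => U x * V x ^ (S j)).
    - intros x. replace (V x ^ S (S j) + INR (S j) * (U x * (V x ^ j * W x)))
        with (V x * V x ^ (S j) + U x * (INR (S j) * W x * V x ^ j)) by (simpl pow; ring).
      apply (is_derive_mult U (fun x => V x ^ (S j))); [apply hUV| |intros; apply Rmult_comm].
      apply (is_derive_pow V (S j)), hVW.
    - prove_cont.
    - now rewrite (periodic1_10 U hU), (periodic1_10 V hV). }
  rewrite mean_plus, mean_scal in h by prove_cont. lra.
Qed.

(** One formula for the mean of [Z V^j] serves three times: [j = 0] determines [c], in [j = 1] the
    two multiples of the mean of [V^3] cancel, and in [j = 2] the fourth moment keeps the factor
    [k2 (1/3 - 1/2) = - k2 / 6]. *)
Lemma evolution_moments (k1 k2 c : R) (U V W Z : R -> R) :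
  periodic1 U -> periodic1 V ->
  (forall x, is_derive U x (V x)) -> (forall x, is_derive V x (W x)) -> cont W ->
  (forall x, Z x = k1 * (V x ^ 2 * W x) - k2 * (U x * W x + / 2 * V x ^ 2) + c) ->
  mean Z = 0 ->
  mean (fun x => Z x * V x) = 0 /\
  mean (fun x => Z x * V x ^ 2)
  = - (k2 / 2) * mean (fun x => V x ^ 2) ^ 2 - k2 / 6 * mean (fun x => V x ^ 4).
Proof.
  intros hU hV hUV hVW hW hZ hZ0.
  pose proof (cont_derivative U V hUV) as cU. pose proof (cont_derivative V W hVW) as cV.
  assert (hint : forall j, mean (fun x => Z x * V x ^ j) =
    k1 * mean (fun x => V x ^ (2 + j) * W x) - k2 * mean (fun x => U x * (V x ^ j * W x))
    - k2 / 2 * mean (fun x => V x ^ (2 + j)) + c * mean (fun x => V x ^ j)).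
  { intros j. rewrite <- !mean_scal, <- !mean_minus, <- mean_plus by prove_cont.
    apply mean_ext; intros x _. rewrite hZ, pow_add. field. }
  assert (hV1 : mean V = 0)
    by (apply mean_periodic_derivative with U; auto using periodic1_10).
  pose proof (fun j => mean_power_derivative V W j hV hVW hW) as p.
  pose proof (fun j => mean_product_derivative U V W j hU hV hUV hVW hW) as q.
  pose proof (q 0%nat) as q0. pose proof (q 1%nat) as q1. pose proof (q 2%nat) as q2.
  pose proof (hint 0%nat) as h0. pose proof (hint 1%nat) as h1. pose proof (hint 2%nat) as h2.
  rewrite p in h0, h1, h2. cbn [Nat.add] in h0, h1, h2.
  replace (INR 1) with 1 in q0 by reflexivity. replace (INR 2) with 2 in q1 by (simpl; ring).
  replace (INR 3) with 3 in q2 by (simpl; ring).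
  rewrite (mean_ext (fun x => Z x * V x ^ 0) Z), hZ0 in h0 by (intros; simpl; ring).
  rewrite (mean_ext (fun x => V x ^ 0) (fun _ => 1)), mean_const in h0 by easy.
  rewrite (mean_ext (fun x => V x ^ 1) V), hV1 in h1 by (intros; simpl; ring).
  rewrite (mean_ext (fun x => Z x * V x ^ 1) (fun x => Z x * V x)) in h1 by (intros; simpl; ring).
  set (H := mean (fun x => V x ^ 2)) in *. set (F := mean (fun x => V x ^ 3)) in *.
  set (E := mean (fun x => V x ^ 4)) in *.
  assert (e0 : mean (fun x => U x * (V x ^ 0 * W x)) = - H) by lra.
  assert (e1 : mean (fun x => U x * (V x ^ 1 * W x)) = - F / 2) by lra.
  assert (e2 : mean (fun x => U x * (V x ^ 2 * W x)) = - E / 3) by lra.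
  rewrite e0 in h0. rewrite e1 in h1. rewrite e2 in h2.
  assert (hc : c = - (k2 / 2) * H) by lra.
  split; [rewrite h1; field|]. rewrite h2, hc. field.
Qed.

(** In the quadratic part the product rule on [U * osc n a] contributes [- m V], which leaves one of
    the two copies of [m V]. *)
Lemma weak_terms (U V W : R -> R) (n : Z) (a : R) :
  periodic1 U -> periodic1 V ->
  (forall x, is_derive U x (V x)) -> (forall x, is_derive V x (W x)) -> cont W ->
  pairing (momentum U) (osc n a) = mean (fun x => (mean U - W x) * osc n a x) /\
  cubic_part U (osc n a) = - (2 * PI * IZR n *
    mean (fun x => (2 * mean U * U x - V x ^ 2) * (mean U - W x) * osc n (a + PI / 2) x)) /\
  quadratic_part U (osc n a) = mean (fun x => (mean U - W x) * V x * osc n a x)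
    - 2 * PI * IZR n * mean (fun x => (mean U - W x) * U x * osc n (a + PI / 2) x).
Proof.
  intros hU hV hUV hVW hW.
  pose proof (cont_derivative U V hUV) as cU. pose proof (cont_derivative V W hVW) as cV.
  pose proof (fun x => momentum_eq U V W x hUV hVW) as hm.
  assert (hD : forall x, Derive U x = V x) by (intros; now apply is_derive_unique).
  assert (hDo : forall x, Derive (osc n a) x = 2 * PI * IZR n * osc n (a + PI / 2) x)
    by (intros; apply is_derive_unique, is_derive_osc).
  assert (hDp : forall x, Derive (fun y => U y * osc n a y) x
    = V x * osc n a x + U x * (2 * PI * IZR n * osc n (a + PI / 2) x)).
  { intros x; apply is_derive_unique.
    apply (is_derive_mult U (osc n a)); [apply hUV|apply is_derive_osc|].
    intros; apply Rmult_comm. }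
  unfold cubic_part, quadratic_part, pairing_dx, pairing.
  repeat split.
  - apply mean_ext; intros x _. now rewrite hm.
  - rewrite <- (mean_scal (2 * PI * IZR n)) by prove_cont. apply (f_equal Ropp), mean_ext; intros x _.
    rewrite hm, hD, hDo; ring.
  - rewrite <- (mean_scal (2 * PI * IZR n)), <- mean_minus by prove_cont.
    transitivity (mean (fun x => 2 * (mean U - W x) * V x * osc n a x)
      - mean (fun x => (mean U - W x) * (V x * osc n a x
           + U x * (2 * PI * IZR n * osc n (a + PI / 2) x)))).
    + apply (f_equal2 Rplus); [|apply (f_equal Ropp)]; apply mean_ext; intros x _;
        [now rewrite hm, hD|now rewrite hm, hDp].
    + rewrite <- mean_minus by prove_cont. apply mean_ext; intros x _; ring.
Qed.

(** Mean zero gives [m = - W], and [V W] is the derivative of [V^2 / 2]. The weak equation at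
    frequency [n] is then [2 PI n] times a coefficient of [G]; dividing for [n <> 0] leaves only the
    coefficient at zero, which is the constant [c]. *)
Lemma weak_to_strong (k1 k2 : R) (U V W Z : R -> R) :
  periodic1 U -> periodic1 V ->
  (forall x, is_derive U x (V x)) -> (forall x, is_derive V x (W x)) -> cont W ->
  mean U = 0 -> periodic1 Z -> cont Z ->
  (forall n a, mean (fun x => Z x * (2 * PI * IZR n * osc n (a + PI / 2) x))
     + k1 * cubic_part U (osc n a) + k2 * quadratic_part U (osc n a) = 0) ->
  exists c, forall x, Z x = k1 * (V x ^ 2 * W x) - k2 * (U x * W x + / 2 * V x ^ 2) + c.
Proof.
  intros hU hV hUV hVW hW hU0 hZp hZ heq.
  pose proof (cont_derivative U V hUV) as cU. pose proof (cont_derivative V W hVW) as cV.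
  pose proof (derivative_periodic V W hV hVW) as hWp.
  set (G := fun x => Z x - k1 * (V x ^ 2 * W x) + k2 * (U x * W x + / 2 * V x ^ 2)).
  assert (hG : cont G) by (unfold G; prove_cont).
  assert (hGn : forall n a, n <> 0%Z -> mean (fun x => G x * osc n a x) = 0).
  { intros n b hn. set (a := b - PI / 2). specialize (heq n a).
    destruct (weak_terms U V W n a hU hV hUV hVW hW) as [_ [ec eq]].
    rewrite ec, eq, hU0 in heq.
    assert (hn' : 2 * PI * IZR n <> 0).
    { apply Rmult_integral_contrapositive_currified; [|now apply eq_IZR_contrapositive].
      generalize PI_RGT_0; lra. }
    replace (a + PI / 2) with b in heq by (unfold a; ring).
    assert (hsq : mean (fun x => V x * W x * osc n a x)
      = - (2 * PI * IZR n * mean (fun x => / 2 * V x ^ 2 * osc n b x))).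
    { replace b with (a + PI / 2) by (unfold a; ring).
      apply (mean_derivative_osc (fun x => / 2 * V x ^ 2) (fun x => V x * W x)).
      - intros x; now rewrite hV.
      - intros x. replace (V x * W x) with (/ 2 * (INR 2 * W x * V x ^ 1)) by (simpl; field).
        apply is_derive_scal, (is_derive_pow V 2), hVW.
      - prove_cont. }
    apply Rmult_eq_reg_l with (2 * PI * IZR n); [|assumption]. rewrite Rmult_0_r, <- heq.
    set (p := 2 * PI * IZR n) in *.
    rewrite (mean_ext (fun x => (0 - W x) * V x * osc n a x)
      (fun x => (-1) * (V x * W x * osc n a x))), mean_scal, hsq by (prove_cont || (intros; ring)).
    match goal with |- _ = _ + k1 * - (p * ?A) + k2 * (-1 * - (p * ?B) - p * ?D) =>
      transitivity (mean (fun x => Z x * (p * osc n b x)) + p * (- k1 * A + k2 * B - k2 * D));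
      [|ring] end.
    rewrite <- !mean_scal, <- mean_plus, <- mean_minus, <- !mean_scal, <- mean_plus by prove_cont.
    apply mean_ext; intros x _. unfold G; ring. }
  exists (mean G). intros x.
  assert (h : G x - mean G = 0); [|unfold G at 1 in h; lra].
  apply (no_fourier_zero (fun x => G x - mean G)); [prove_cont| |].
  - intros y. unfold G. now rewrite hZp, hU, hV, hWp.
  - intros n a.
    rewrite (mean_ext _ (fun x => G x * osc n a x - mean G * osc n a x)) by (intros; ring).
    rewrite mean_minus, mean_scal by prove_cont. destruct (Z.eq_dec n 0) as [->|hn].
    + rewrite mean_osc_0.
      rewrite (mean_ext _ (fun x => cos a * G x)), mean_scal by
        (assumption || (intros; unfold osc; rewrite Rmult_0_r, Rmult_0_l, Rplus_0_l; ring)).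
      ring.
    + rewrite hGn, mean_osc by assumption; ring.
Qed.

(** * From curves in Sobolev spaces to classical derivatives *)

Lemma Hs_C1 (s : R) :
  3 / 2 < s ->
  exists K, 0 < K /\ forall f, Hs s f ->
    cont (Derive f) /\ (forall x, is_derive f x (Derive f x)) /\
    forall e, 0 < e -> Hs_norm s f <= e -> forall x, Rabs (Derive f x) <= K * e.
Proof.
  intros hs. destruct (Hs_derivative s hs) as [K [hK h]]. exists K; split; [assumption|].
  intros f hf. destruct (h f hf) as [g [hg [hd hb]]].
  replace (Derive f) with g; [auto|].
  apply functional_extensionality; intros x. symmetry; now apply is_derive_unique.
Qed.

Lemma Hs_C2 (s : R) (f : R -> R) :
  5 / 2 < s -> Hs s f ->
  cont (Derive (Derive f)) /\ forall x, is_derive (Derive f) x (Derive (Derive f) x).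
Proof.
  intros hs hf. destruct (Hs_C1 s ltac:(lra)) as [K [_ hK]]. destruct (hK f hf) as [hg [hd _]].
  destruct (Hs_derivative2 s f (Derive f) hs hf hd hg) as [h [hh hdh]].
  replace (Derive (Derive f)) with h; [auto|].
  apply functional_extensionality; intros x. symmetry; now apply is_derive_unique.
Qed.

Lemma filterlim_within_0 (N : R -> R) (D : R -> Prop) (t e : R) :
  filterlim N (within D (locally t)) (locally 0) -> 0 < e ->
  exists d, 0 < d /\ forall tau, Rabs (tau - t) < d -> D tau -> N tau <= e.
Proof.
  intros h he.
  destruct (proj1 (filterlim_locally N 0) h (mkposreal e he)) as [d hd].
  exists d; split; [apply cond_pos|]. intros tau ht hD.
  specialize (hd tau ht hD). unfold ball in hd; simpl in hd.
  unfold AbsRing_ball, abs, minus, plus, opp in hd; simpl in hd. apply Rabs_def2 in hd. lra.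
Qed.

(** The error of the difference quotient is small in [H^s], so the embedding bounds its
    [x]-derivative uniformly. For the solution this is used at regularity [s - 1]. *)
Lemma unif_derivative_Derive (s t : R) (u : R -> R -> R) (ut : R -> R) :
  3 / 2 < s -> 0 < t -> (forall tau, 0 <= tau -> Hs s (u tau)) -> Hs s ut ->
  filterlim (fun t' => Hs_norm s (fun x => (u t' x - u t x) / (t' - t) - ut x))
    (within (time_interval p_infty) (locally' t)) (locally 0) ->
  unif_derivative (fun tau => Derive (u tau)) t (Derive ut).
Proof.
  intros hs ht hu hut hlim. destruct (Hs_C1 s hs) as [K [hK hC1]].
  destruct (hC1 ut hut) as [cut [dut _]].
  split; [assumption|split].
  - exists t; split; [assumption|]. intros tau htau. apply Rabs_def2 in htau.
    apply (hC1 (u tau)), hu; lra.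
  - intros e he.
    destruct (filterlim_within_0
      (fun t' => Hs_norm s (fun x => (u t' x - u t x) / (t' - t) - ut x))
      (fun tau => tau <> t /\ time_interval p_infty tau) t (e / K)) as [d [hd h]].
    (* The puncture at [t] is moved from the filter into the domain condition. *)
    { intros P HP. destruct (hlim P HP) as [r hr]. exists r.
      intros y hy [hy1 hy2]. now apply hr. }
    { now apply Rdiv_lt_0_compat. }
    exists (Rmin d t); split; [now apply Rmin_glb_lt|]. intros tau htau x _.
    assert (h1 : Rabs (tau - t) < d) by (eapply Rlt_le_trans; [exact htau|apply Rmin_l]).
    assert (h2 : Rabs (tau - t) < t) by (eapply Rlt_le_trans; [exact htau|apply Rmin_r]).
    apply Rabs_def2 in h2.
    destruct (Req_dec tau t) as [->|hne].
    { replace (Derive (u t) x - Derive (u t) x - (t - t) * Derive ut x) with 0 by ring.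
      rewrite Rminus_diag, Rabs_R0; lra. }
    assert (hnz : tau - t <> 0) by lra.
    assert (hq : Hs s (fun x => (u tau x - u t x) / (tau - t) - ut x)).
    { replace (fun x => (u tau x - u t x) / (tau - t) - ut x) with
        (fun x => 1 * (/ (tau - t) * u tau x + - / (tau - t) * u t x) + (-1) * ut x).
      - apply (Hs_linear s 1 (-1) (fun x => / (tau - t) * u tau x + - / (tau - t) * u t x));
          [apply Hs_linear; apply hu; lra|assumption].
      - apply functional_extensionality; intros y. field; assumption. }
    destruct (hC1 _ hq) as [_ [_ hb]].
    assert (htau0 : 0 <= tau) by lra.
    specialize (hb (e / K) (Rdiv_lt_0_compat _ _ he hK)
      (h tau h1 (conj hne (conj htau0 I))) x).
    replace (K * (e / K)) with e in hb by (field; lra).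
    destruct (hC1 _ (hu tau htau0)) as [_ [d1 _]].
    destruct (hC1 _ (hu t (Rlt_le _ _ ht))) as [_ [d2 _]].
    replace (Derive (fun y => (u tau y - u t y) / (tau - t) - ut y) x)
      with ((Derive (u tau) x - Derive (u t) x) / (tau - t) - Derive ut x) in hb.
    + replace (Derive (u tau) x - Derive (u t) x - (tau - t) * Derive ut x) with
        (((Derive (u tau) x - Derive (u t) x) / (tau - t) - Derive ut x) * (tau - t))
        by (field; assumption).
      rewrite Rabs_mult. apply Rmult_le_compat_r; [apply Rabs_pos|assumption].
    + symmetry; apply is_derive_unique.
      apply (is_derive_minus (V := R_NormedModule)
        (fun y => (u tau y - u t y) / (tau - t)) ut); [|apply dut].
      apply (is_derive_ext (fun y => / (tau - t) * (u tau y - u t y)));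
        [intros; unfold Rdiv; simpl; ring|].
      replace ((Derive (u tau) x - Derive (u t) x) / (tau - t)) with
        (/ (tau - t) * (Derive (u tau) x - Derive (u t) x)) by (unfold Rdiv; ring).
      apply is_derive_scal.
      apply (is_derive_minus (V := R_NormedModule) (u tau) (u t)); auto.
Qed.

(** * Conserved quantities and the contradiction *)

Lemma positive_time_const (y : R -> R) :
  (forall t, 0 < t -> is_derive y t 0) -> forall t t', 0 < t -> 0 < t' -> y t = y t'.
Proof.
  intros h t t' ht ht'. destruct (Rtotal_order t t') as [hl|[->|hl]]; [|easy|symmetry];
    (apply (eq_is_derive (V := R_NormedModule)); [intros; apply h; lra | assumption]).
Qed.

Lemma no_global_solution (k1 k2 s : R) (u0 : R -> R) (u : R -> R -> R) :
  0 < k2 -> 5 / 2 < s -> ~ (forall x, u0 x = 0) -> mean u0 = 0 ->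
  ~ strong_solution k1 k2 s u0 p_infty u.
Proof.
  intros hk2 hs hu0 hmean [_ [hC0 [[hC0' [ut [hut hlim]]] [heq hinit]]]].
  set (v := fun t => Derive (u t)). set (w := fun t => Derive (v t)).
  set (z := fun t => Derive (ut t)).
  assert (hH : forall t, 0 <= t -> Hs s (u t)) by (intros t ht; apply (hC0 t); now split).
  destruct (Hs_C1 s ltac:(lra)) as [K [hK hC1]].
  destruct (Hs_C1 (s - 1) ltac:(lra)) as [K' [_ hC1']].
  assert (pu : forall t, 0 <= t -> periodic1 (u t)) by (intros t ht; apply (hH t ht)).
  assert (du : forall t, 0 <= t -> forall x, is_derive (u t) x (v t x))
    by (intros t ht; apply (hC1 _ (hH t ht))).
  assert (cv : forall t, 0 <= t -> cont (v t)) by (intros t ht; apply (hC1 _ (hH t ht))).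
  assert (dv : forall t, 0 <= t -> forall x, is_derive (v t) x (w t x))
    by (intros t ht; apply (Hs_C2 s _ hs (hH t ht))).
  assert (cw : forall t, 0 <= t -> cont (w t))
    by (intros t ht; apply (Hs_C2 s _ hs (hH t ht))).
  assert (pv : forall t, 0 <= t -> periodic1 (v t))
    by (intros t ht; apply derivative_periodic with (u t); auto).
  assert (hutH : forall t, 0 <= t -> Hs (s - 1) (ut t))
    by (intros t ht; apply (hut t); now split).
  assert (dut : forall t, 0 <= t -> forall x, is_derive (ut t) x (z t x))
    by (intros t ht; apply (hC1' _ (hutH t ht))).
  assert (cz : forall t, 0 <= t -> cont (z t)) by (intros t ht; apply (hC1' _ (hutH t ht))).
  assert (put : forall t, 0 <= t -> periodic1 (ut t)) by (intros t ht; apply (hutH t ht)).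
  assert (pz : forall t, 0 <= t -> periodic1 (z t))
    by (intros t ht; apply derivative_periodic with (ut t); auto).
  assert (mz : forall t, 0 <= t -> mean (z t) = 0)
    by (intros t ht; apply mean_periodic_derivative with (ut t); auto using periodic1_10).
  assert (hvz : forall t, 0 < t -> unif_derivative v t (z t)).
  { intros t ht. apply unif_derivative_Derive with (s - 1); auto; try lra.
    - intros tau h. apply (hC0' tau); now split.
    - apply hutH; lra.
    - apply (hlim t). split; [lra|easy]. }
  (* The bridge to the initial datum: everything derived from the equation holds for [t > 0], and
     some positive time is as close to [t = 0] as desired in both mean and [v]. *)
  assert (hcont0 : forall e, 0 < e -> exists tau, 0 < tau /\
    Rabs (mean (u tau) - mean (u 0)) <= e /\ forall x, Rabs (v tau x - v 0 x) <= K * e).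
  { intros e he.
    destruct (hC0 0 (conj (Rle_refl 0) I)) as [_ hl].
    destruct (filterlim_within_0 _ _ 0 e hl he) as [d [hd h]].
    exists (d / 2); split; [lra|].
    assert (ht : 0 <= d / 2) by lra.
    assert (hn : Hs_norm s (fun x => u (d / 2) x - u 0 x) <= e).
    { apply h; [rewrite Rminus_0_r, Rabs_pos_eq; lra|now split]. }
    assert (hd' : Hs s (fun x => u (d / 2) x - u 0 x)).
    { replace (fun x => u (d / 2) x - u 0 x) with (fun x => 1 * u (d / 2) x + (-1) * u 0 x)
        by (apply functional_extensionality; intros; ring).
      apply Hs_linear; apply hH; lra. }
    split.
    - pose proof (cont_derivative _ _ (du (d / 2) ht)) as c1.
      pose proof (cont_derivative _ _ (du 0 (Rle_refl 0))) as c2.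
      rewrite <- mean_minus by assumption.
      apply (Hs_mean s e _ hd' (Rlt_le _ _ he) hn).
    - intros x. destruct (hC1 _ hd') as [_ [_ hb]]. specialize (hb e he hn x).
      replace (v (d / 2) x - v 0 x) with (Derive (fun x => u (d / 2) x - u 0 x) x); [assumption|].
      apply is_derive_unique, (is_derive_minus (V := R_NormedModule) (u (d / 2)) (u 0));
        apply du; lra. }
  assert (hwt : forall t, 0 <= t -> forall n a, _)
    by (intros t ht n a; exact (weak_terms (u t) (v t) (w t) n a (pu t ht) (pv t ht)
          (du t ht) (dv t ht) (cw t ht))).
  assert (mw : forall t, 0 <= t -> mean (w t) = 0)
    by (intros t ht; apply mean_periodic_derivative with (v t); auto using periodic1_10).
  assert (osc00 : forall x, osc 0 0 x = 1).
  { intros x; unfold osc. rewrite Rmult_0_r, Rmult_0_l, Rplus_0_r. apply cos_0. }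
  (* Tested against the constant 1, the divergence terms carry the factor [n = 0], and the remaining
     [m v] is an exact [x]-derivative. *)
  assert (hmd : forall t, 0 < t -> is_derive (fun tau => mean (u tau)) t 0).
  { intros t ht. destruct (heq t ht I (osc 0 0) (test_function_osc 0 0)) as [dm [hdm e]].
    assert (ht' : 0 <= t) by lra.
    destruct (hwt t ht' 0%Z 0) as [_ [ec eq]]. rewrite ec, eq in e.
    pose proof (cv t ht') as c1. pose proof (cw t ht') as c2.
    assert (hm0 : mean (fun x => (mean (u t) - w t x) * v t x * osc 0 0 x) = 0).
    { rewrite (mean_ext _ (fun x => mean (u t) * v t x - v t x ^ 1 * w t x))
        by (intros; rewrite osc00; ring).
      rewrite mean_minus, mean_scal by prove_cont.
      rewrite (mean_power_derivative (v t) (w t) 1) by auto.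
      rewrite (mean_periodic_derivative (u t) (v t)) by auto using periodic1_10. ring. }
    rewrite hm0 in e. replace 0 with dm by lra.
    apply (is_derive_ext_loc (fun tau => pairing (momentum (u tau)) (osc 0 0))); [|assumption].
    exists (mkposreal t ht). intros tau htau.
    assert (h0 : 0 <= tau).
    { change (Rabs (tau - t) < t) in htau. apply Rabs_def2 in htau. lra. }
    destruct (hwt tau h0 0%Z 0) as [-> _].
    rewrite (mean_ext _ (fun x => mean (u tau) - w tau x)) by (intros; rewrite osc00; ring).
    rewrite mean_minus, mean_const, mw, Rminus_0_r by (auto using cont_const). reflexivity. }
  assert (hm : forall t, 0 <= t -> mean (u t) = 0).
  { assert (h0 : mean (u 0) = 0)
      by (transitivity (mean u0); [apply mean_ext; intros; apply hinit|assumption]).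
    intros t [ht|<-]; [|assumption]. apply cond_eq. intros e he.
    destruct (hcont0 (e / 2) ltac:(lra)) as [tau [htau [h _]]].
    rewrite (positive_time_const _ hmd t tau ht htau). rewrite h0 in h. lra. }
  assert (hstrong : forall t, 0 < t -> exists c, forall x, z t x =
    k1 * (v t x ^ 2 * w t x) - k2 * (u t x * w t x + / 2 * v t x ^ 2) + c).
  { intros t ht. assert (ht' : 0 <= t) by lra.
    apply weak_to_strong; auto. intros n a.
    destruct (heq t ht I (osc n a) (test_function_osc n a)) as [dm [hdm e]].
    rewrite <- e. do 2 f_equal.
    (* Integration by parts turns the pairing of [m = - v_x] with [osc n a] into the mean of
       [v * phi], which can be differentiated in time; this identifies [dm] with the mean of
       [z * phi]. *)
    set (phi := fun x => 2 * PI * IZR n * osc n (a + PI / 2) x).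
    assert (hphi : cont phi) by (unfold phi; prove_cont).
    pose proof (is_derive_mean _ _ _ (unif_derivative_mult v (fun _ => phi) t (z t) (fun _ => 0)
      (hvz t ht) (unif_derivative_const phi t hphi))) as hd.
    transitivity (mean (fun x => z t x * phi x + v t x * 0)).
    { apply mean_ext; intros; unfold phi; ring. }
    rewrite <- (is_derive_unique _ _ _ hd), <- (is_derive_unique _ _ _ hdm).
    apply Derive_ext_loc. exists (mkposreal t ht). intros tau htau.
    assert (h0 : 0 <= tau).
    { change (Rabs (tau - t) < t) in htau. apply Rabs_def2 in htau. lra. }
    destruct (hwt tau h0 n a) as [-> _]. pose proof (cw tau h0). pose proof (cv tau h0).
    rewrite hm by assumption.
    rewrite (mean_ext (fun x => (0 - w tau x) * osc n a x) (fun x => (-1) * (w tau x * osc n a x))), mean_scal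
      by (prove_cont || (intros; ring)).
    rewrite (mean_derivative_osc (v tau) (w tau)) by auto.
    transitivity (2 * PI * IZR n * mean (fun x => v tau x * osc n (a + PI / 2) x)); [|ring].
    rewrite <- mean_scal by prove_cont. apply mean_ext; intros; unfold phi; ring. }
  (* [H] and [F] are written with products, the form delivered by the uniform product rule. *)
  set (H := fun t => mean (fun x => v t x * v t x)).
  set (F := fun t => mean (fun x => v t x * (v t x * v t x))).
  set (E := fun t => mean (fun x => v t x ^ 4)).
  assert (hmom : forall t, 0 < t -> is_derive H t 0 /\
    is_derive F t (- (3 * k2 / 2) * H t ^ 2 - k2 / 2 * E t)).
  { intros t ht. assert (ht' : 0 <= t) by lra. destruct (hstrong t ht) as [c hc].
    destruct (evolution_moments k1 k2 c (u t) (v t) (w t) (z t)) as [e1 e2]; auto.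
    pose proof (cv t ht'). pose proof (cz t ht').
    pose proof (unif_derivative_mult v v t _ _ (hvz t ht) (hvz t ht)) as hvv.
    pose proof (unif_derivative_mult _ _ t _ _ (hvz t ht) hvv) as hvvv.
    apply is_derive_mean in hvv. apply is_derive_mean in hvvv. split.
    - replace 0 with (mean (fun x => z t x * v t x + v t x * z t x)); [assumption|].
      rewrite (mean_ext _ (fun x => 2 * (z t x * v t x))), mean_scal, e1
        by (prove_cont || (intros; ring)). ring.
    - match type of hvvv with is_derive _ _ ?l =>
        replace (- (3 * k2 / 2) * H t ^ 2 - k2 / 2 * E t) with l; [assumption|] end.
      rewrite (mean_ext _ (fun x => 3 * (z t x * v t x ^ 2))), mean_scal, e2
        by (prove_cont || (intros; ring)).
      fold (E t). replace (mean (fun x => v t x ^ 2)) with (H t)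
        by (apply mean_ext; intros; ring). field. }
  assert (hHc : forall t, 0 < t -> H t = H 1)
    by (intros t ht; apply positive_time_const; try lra; intros; now apply hmom).
  pose proof (cv 0 (Rle_refl 0)) as cv0.
  (* Otherwise [H] is nonpositive at all positive times, hence [v 0 = 0] in the limit; then [u0] is
     constant of mean zero. *)
  assert (hH1 : 0 < H 1).
  { destruct (Rlt_or_le 0 (H 1)) as [|hle]; [assumption|exfalso].
    apply hu0.
    assert (hv0 : forall x, v 0 x = 0).
    { apply mean_sqr_zero; auto using Rle_refl.
      apply le_epsilon. intros e he.
      (* Makes [(K r)^2 = e / 2], so that [v0^2 <= 2 v^2 + 2 (v - v0)^2 <= 2 v^2 + e]. *)
      set (r := sqrt (e / 2) / K).
      assert (hr : 0 < r) by (apply Rdiv_lt_0_compat; [apply sqrt_lt_R0; lra|assumption]).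
      assert (hr2 : (K * r) ^ 2 = e / 2).
      { unfold r. replace (K * (sqrt (e / 2) / K)) with (sqrt (e / 2)) by (field; lra).
        apply pow2_sqrt; lra. }
      destruct (hcont0 r hr) as [tau [htau [_ h]]].
      pose proof (cv tau (Rlt_le _ _ htau)).
      apply Rle_trans with (mean (fun x => 2 * (v tau x * v tau x) + e)).
      - apply mean_le; [prove_cont|prove_cont|]. intros x _. specialize (h x).
        apply Rabs_le_between in h. assert (0 < K * r) by nra.
        assert ((v tau x - v 0 x) ^ 2 <= (K * r) ^ 2) by (apply pow_maj_Rabs, Rabs_le; assumption).
        pose proof (pow2_ge_0 (2 * v tau x - v 0 x)). nra.
      - rewrite mean_plus, mean_scal, mean_const by prove_cont.
        change (2 * H tau + e <= 0 + e). rewrite hHc by assumption. lra. }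
    assert (hc : forall x, u 0 x = u 0 0).
    { intros x. apply (zero_derivative_const (u 0)). intros y.
      pose proof (du 0 (Rle_refl 0) y) as h. rewrite hv0 in h. exact h. }
    intros x. rewrite <- hinit, hc. transitivity (mean u0); [|assumption].
    rewrite <- (mean_const (u 0 0)). apply mean_ext; intros y _. rewrite <- hinit; symmetry; apply hc. }
  (* The first entry pays for the [1] and the second for the [F^2] in [F' <= - a (1 + F^2)]. *)
  set (a := Rmin (3 * k2 / 2 * H 1 ^ 2) (k2 / (2 * H 1))).
  apply (riccati_no_global a F (fun t => - (3 * k2 / 2) * H t ^ 2 - k2 / 2 * E t)).
  - apply Rmin_glb_lt; [apply Rmult_lt_0_compat; nra|apply Rdiv_lt_0_compat; lra].
  - intros t ht. split; [now apply hmom|]. rewrite hHc by assumption.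
    pose proof (cv t (Rlt_le _ _ ht)) as ct.
    (* Cauchy-Schwarz: expand [mean ((v^2 - l v)^2) >= 0] at [l = F / H]. *)
    assert (hCS : F t ^ 2 <= H 1 * E t).
    { set (l := F t / H 1).
      assert (h : 0 <= mean (fun x => (v t x ^ 2 - l * v t x) ^ 2)).
      { rewrite <- (mean_const 0). apply mean_le; try prove_cont.
        intros x _; apply pow2_ge_0. }
      rewrite (mean_ext _ (fun x => v t x ^ 4 - 2 * l * (v t x * (v t x * v t x))
        + l ^ 2 * (v t x * v t x))) in h by (intros; ring).
      rewrite mean_plus, mean_minus, !mean_scal in h by prove_cont.
      fold (E t) (F t) (H t) in h. rewrite hHc in h by assumption.
      assert (hl : F t = l * H 1) by (unfold l; field; lra).
      rewrite hl in h |- *. nra. }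
    assert (a1 : a <= 3 * k2 / 2 * H 1 ^ 2) by apply Rmin_l.
    assert (a2 : a * F t ^ 2 <= k2 / 2 * E t).
    { apply Rle_trans with (k2 / (2 * H 1) * F t ^ 2).
      - apply Rmult_le_compat_r; [apply pow2_ge_0|apply Rmin_r].
      - apply Rle_trans with (k2 / (2 * H 1) * (H 1 * E t)).
        + apply Rmult_le_compat_l; [apply Rlt_le, Rdiv_lt_0_compat; lra|assumption].
        + right; field; lra. }
    lra.
Qed.

Theorem theorem7p1 (k1 k2 s : R) (u0 : R -> R) (Tstar : Rbar) (u : R -> R -> R)
    (hk1 : 0 < k1) (hk2 : 0 < k2) (hs : 5 / 2 < s)
    (hu0 : Hs s u0) (hu0_neq0 : ~ (forall x, u0 x = 0)) (hmean : mean u0 = 0)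
    (hu : maximal_strong_solution k1 k2 s u0 Tstar u) :
  Rbar_lt Tstar p_infty.
Proof.
  destruct hu as [hsol _]. destruct Tstar as [T| |]; [exact I| |exact I].
  exact (no_global_solution k1 k2 s u0 u hk2 hs hu0_neq0 hmean hsol).
Qed.
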